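(* Let $X=\ell_q$ (complex) with $1\le q<\infty$. A typical $T\in(\mathcal{P}_1(X),\mathrm{SOT})$ is such that $T^*$ has no eigenvalue. If $1<q<\infty$, a typical $T\in(\mathcal{P}_1(X),\mathrm{SOT}^* )$ is such that $T$ and $T^*$ have no eigenvalue.
   Context: $X=\ell_q=\ell_q(\mathbb{Z}_+)$ is equipped with its canonical basis. A vector is positive if all its coordinates are $\ge0$; a bounded operator $T$ on $X$ is positive if it maps positive vectors to positive vectors. $\mathcal{P}_1(X)$ is the set of bounded positive operators with $\|T\|\le1$. $T^*$ is the adjoint acting on $X^*$. $\mathrm{SOT}$: $T_i\to T$ iff $\|T_ix-Tx\|\to0$ for every $x\in X$. $\mathrm{SOT}^*$: $T_i\to T$ iff $\|T_ix-Tx\|\to0$ for every $x\in X$ and $\|T_i^*x^*-T^*x^*\|\to0$ for every $x^*\in X^*$. ''A typical $T\in(\mathcal{P}_1(X),\tau)$ has property (P)'' means that the set of $T\in\mathcal{P}_1(X)$ with (P) is comeager, i.e. contains a dense $G_\delta$ subset of $(\mathcal{P}_1(X),\tau)$. *)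

(* Defs.v *)
From HB Require Import structures.
From mathcomp Require Import all_boot all_order all_algebra.
From mathcomp Require Import all_classical all_reals all_analysis.
From mathcomp Require Import borel_hierarchy.
From mathcomp Require Import complex.

Set Implicit Arguments.
Unset Strict Implicit.
Unset Printing Implicit Defensive.

Import Order.TTheory GRing.Theory Num.Theory.
Import numFieldNormedType.Exports.

Local Open Scope classical_set_scope.
Local Open Scope complex_scope.
Local Open Scope ring_scope.

(* Norms on normed modules over R[i] take their values in R[i]; this is the
   same norm read as an element of R. *)
Definition rnorm (R : realType) (V : normedZmodType R[i]) (v : V) : R :=
  complex.Re `|v|.
Arguments rnorm {R V} v.

Section rnorm_theory.
Context (R : realType) (V : normedZmodType R[i]).
Implicit Types v w : V.

Lemma rnormE v : `|v| = (rnorm v)%:C.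
Proof.
rewrite /rnorm; have := normr_ge0 v; case: `|v| => a b.
by rewrite lecE/= => /andP[/eqP -> _].
Qed.

Lemma rnorm_ge0 v : 0 <= rnorm v.
Proof. by rewrite -ler0c -rnormE. Qed.

Lemma rnorm0 : rnorm (0 : V) = 0.
Proof. by rewrite /rnorm normr0. Qed.

Lemma rnorm_eq0 v : rnorm v = 0 -> v = 0.
Proof. by move=> v0; apply/eqP; rewrite -normr_eq0 rnormE v0. Qed.

Lemma ler_rnormD v w : rnorm (v + w) <= rnorm v + rnorm w.
Proof. by rewrite -lecR rmorphD/= -!rnormE ler_normD. Qed.

End rnorm_theory.

Lemma rnormZ (R : realType) (V : normedModType R[i]) (a : R[i]) (v : V) :
  rnorm (a *: v) = rnorm a * rnorm v.
Proof. by apply: complexI; rewrite rmorphM/= -!rnormE normrZ. Qed.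

Lemma rnormM (R : realType) (a b : R[i]) : rnorm (a * b) = rnorm a * rnorm b.
Proof. by apply: complexI; rewrite rmorphM/= -!rnormE normrM. Qed.

Section lq_function.
Context (R : realType) (q : R).
Implicit Types x y : nat -> R[i].
Local Open Scope ereal_scope.

Let N x := 'N[counting]_q%:E[EFin \o (rnorm \o x)].

Lemma lq_LnormE x : (1 <= q)%R ->
  N x = (\sum_(n <oo) (rnorm (x n) `^ q)%:E) `^ q^-1.
Proof.
move=> q1; rewrite /N Lnorm_counting ?(lt_le_trans _ q1)//; congr (_ `^ _).
by apply: eq_eseriesr => n _ /=; rewrite ger0_norm ?rnorm_ge0.
Qed.

Lemma le_lq_Lnorm x (y : nat -> R) : (1 <= q)%R ->
  (forall n, (rnorm (x n) <= y n)%R) -> N x <= 'N[counting]_q%:E[EFin \o y].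
Proof.
move=> q1 xy; have q0 : (0 < q)%R by exact: lt_le_trans q1.
rewrite lq_LnormE// Lnorm_counting//; apply: gt0_ler_poweR.
- by rewrite invr_ge0 ltW.
- rewrite in_itv/= leey andbT; apply: nneseries_ge0 => n _ _.
  by rewrite lee_fin powR_ge0.
- rewrite in_itv/= leey andbT; apply: nneseries_ge0 => n _ _.
  by rewrite lee_fin powR_ge0.
- apply: lee_nneseries => n _; first by rewrite lee_fin powR_ge0.
  have y0 : (0 <= y n)%R by rewrite (le_trans _ (xy n)) ?rnorm_ge0.
  rewrite /= ger0_norm// lee_fin ge0_ler_powR ?nnegrE ?rnorm_ge0//.
  exact: ltW.
Qed.

Lemma lq_LnormD x y : (1 <= q)%R -> N (x + y)%R <= N x + N y.
Proof.
move=> q1; have /le_trans : N (x + y)%R <=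
    'N[counting]_q%:E[EFin \o ((rnorm \o x) \+ (rnorm \o y))%R].
  by apply: le_lq_Lnorm => // n; exact: ler_rnormD.
by apply; apply: eminkowski.
Qed.

Lemma lq_LnormZ (a : R[i]) x : (1 <= q)%R -> N (a *: x)%R = (rnorm a)%:E * N x.
Proof.
move=> q1; have q0 : (0 < q)%R by exact: lt_le_trans q1.
rewrite !lq_LnormE//; under eq_eseriesr => n _.
  by rewrite [(a *: x) n]/(a * x n)%R rnormM powRM ?rnorm_ge0// EFinM; over.
rewrite nneseriesZl; last by move=> n _; rewrite lee_fin powR_ge0.
rewrite poweRM ?lee_fin ?powR_ge0//; last first.
  by apply: nneseries_ge0 => n _ _; rewrite lee_fin powR_ge0.
by rewrite poweR_EFin -powRrM divff ?gt_eqF// powRr1 ?rnorm_ge0.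
Qed.

Lemma lq_Lnorm_coord x n : (1 <= q)%R -> (rnorm (x n))%:E <= N x.
Proof.
move=> q1; have q0 : (0 < q)%R by exact: lt_le_trans q1.
have -> : (rnorm (x n))%:E = (rnorm (x n) `^ q)%:E `^ q^-1.
  by rewrite poweR_EFin -powRrM divff ?gt_eqF// powRr1 ?rnorm_ge0.
have s0 k : 0 <= (rnorm (x k) `^ q)%:E by rewrite lee_fin powR_ge0.
rewrite lq_LnormE//; apply: gt0_ler_poweR.
- by rewrite invr_ge0 ltW.
- by rewrite in_itv/= leey andbT.
- by rewrite in_itv/= leey andbT; apply: nneseries_ge0 => k _ _.
- apply: le_trans (nneseries_lim_ge n.+1 _) => //.
  by rewrite big_nat_recr//= leeDr// sume_ge0.
Qed.

End lq_function.

Section lq.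
Context (R : realType) (q : R).

(* The proof of 1 <= q is carried by the predicate, hence by the type, because
   closure under addition depends on it. *)
Definition lq_fun of 1 <= q : {pred nat -> R[i]} :=
  fun x => finite_norm counting q%:E (rnorm \o x).

Context (q1 : 1 <= q).

Lemma lq_funE x : (x \in lq_fun q1) =
  ('N[counting]_q%:E[EFin \o (rnorm \o x)] < +oo)%E.
Proof. by []. Qed.

Lemma lq_submod_closed : submod_closed (lq_fun q1).
Proof.
split=> [|a x y]; rewrite !lq_funE; last move=> xq yq.
  have := lq_LnormZ 0 0 q1; rewrite scale0r rnorm0 mul0e => ->.
  exact: ltry.
apply: le_lt_trans (lq_LnormD _ _ q1) _.
rewrite lq_LnormZ// lte_add_pinfty// lte_mul_pinfty ?lee_fin ?rnorm_ge0//.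
Qed.

HB.instance Definition _ :=
  GRing.isSubmodClosed.Build _ _ (lq_fun q1) lq_submod_closed.

Record lq := Lq { lq_val :> nat -> R[i] ; lq_valP : lq_val \in lq_fun q1 }.

HB.instance Definition _ := [isSub for lq_val].
HB.instance Definition _ := [Choice of lq by <:].
HB.instance Definition _ := [SubChoice_isSubLmodule of lq by <:].

Definition lq_norm (x : lq) : R :=
  fine 'N[counting]_q%:E[EFin \o (rnorm \o x)]%E.

Lemma lq_normE (x : lq) :
  (lq_norm x)%:E = 'N[counting]_q%:E[EFin \o (rnorm \o x)]%E.
Proof. by rewrite fineK// ge0_fin_numE ?Lnorm_ge0//; exact: lq_valP. Qed.

Let normD (x y : lq) :
  (lq_norm (x + y))%:C <= (lq_norm x)%:C + (lq_norm y)%:C :> R[i].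
Proof.
by rewrite -rmorphD/= lecR -lee_fin EFinD !lq_normE; exact: lq_LnormD.
Qed.

Let normZ (a : R[i]) (x : lq) : (lq_norm (a *: x))%:C = `|a| * (lq_norm x)%:C.
Proof.
rewrite rnormE -rmorphM/=; congr (_%:C); apply: EFin_inj.
by rewrite EFinM !lq_normE; exact: lq_LnormZ.
Qed.

Let norm_eq0 (x : lq) : (lq_norm x)%:C = 0 :> R[i] -> x = 0.
Proof.
move=> /complexI x0; apply/val_inj/funext => n; apply: rnorm_eq0.
apply/eqP; rewrite eq_le rnorm_ge0 andbT -x0 -lee_fin lq_normE.
exact: lq_Lnorm_coord.
Qed.

HB.instance Definition _ := Lmodule_isNormed.Build R[i] lq normD normZ norm_eq0.

Lemma rnorm_lqE (x : lq) :
  (rnorm x)%:E = ((\sum_(n <oo) (rnorm (x n) `^ q)%:E) `^ q^-1)%E.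
Proof. by rewrite -lq_LnormE// -lq_normE. Qed.

End lq.

Section blin.
Context (R : realType) (V W : normedModType R[i]).

Definition blin_fun : {pred V -> W} := fun f =>
  `[< linear f /\ exists M : R, forall x, rnorm (f x) <= M * rnorm x >].

Lemma blin_funP (f : V -> W) : reflect
  (linear f /\ exists M : R, forall x, rnorm (f x) <= M * rnorm x)
  (f \in blin_fun).
Proof. exact: asboolP. Qed.

Lemma blin_submod_closed : submod_closed blin_fun.
Proof.
split=> [|a f g]; last first.
  move=> /blin_funP[fl [M fM]] /blin_funP[gl [K gK]]; apply/blin_funP; split.
  - move=> b u v; rewrite !fctE/= fl gl !scalerDr !scalerA [a * b]mulrC.
    by rewrite addrACA.
  - exists (rnorm a * M + K) => x; rewrite mulrDl -mulrA.
    rewrite (le_trans (ler_rnormD _ _))// lerD//.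
    by rewrite [(a *: f) x]/(a *: f x) rnormZ ler_wpM2l ?rnorm_ge0.
apply/blin_funP; split.
- by move=> a u v /=; rewrite scaler0 addr0.
- by exists 0 => x; rewrite rnorm0 mul0r.
Qed.

HB.instance Definition _ :=
  GRing.isSubmodClosed.Build _ _ blin_fun blin_submod_closed.

Record blin := Blin { blin_val :> V -> W ; blin_valP : blin_val \in blin_fun }.

HB.instance Definition _ := [isSub for blin_val].
HB.instance Definition _ := [Choice of blin by <:].
HB.instance Definition _ := [SubChoice_isSubLmodule of blin by <:].

Lemma blin_linear (f : blin) : linear f.
Proof. by have /blin_funP[] := blin_valP f. Qed.

HB.instance Definition _ (f : blin) :=
  GRing.isLinear.Build R[i] V W _ f (blin_linear f).

Definition op_norm (f : blin) : R :=
  sup [set rnorm (f x) | x in [set x | rnorm x <= 1]].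

Implicit Types f g : blin.

Local Notation unit_image f := [set rnorm (f x) | x in [set x : V | rnorm x <= 1]].

Let unit_image_neq0 f : unit_image f !=set0.
Proof. by exists (rnorm (f 0)); exists 0 => //=; rewrite rnorm0. Qed.

Let unit_image_ub f : has_ubound (unit_image f).
Proof.
have /blin_funP[_ [M fM]] := blin_valP f; exists `|M| => _ [x /= x1 <-].
apply: le_trans (fM x) _; apply: le_trans (ler_norm _) _.
by rewrite normrM ler_piMr// ger0_norm ?rnorm_ge0.
Qed.

Lemma op_norm_ub f (x : V) : rnorm x <= 1 -> rnorm (f x) <= op_norm f.
Proof. by move=> x1; apply: ub_le_sup => //; exists x. Qed.

Lemma op_norm_le f (M : R) :
  (forall x : V, rnorm x <= 1 -> rnorm (f x) <= M) -> op_norm f <= M.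
Proof. by move=> fM; apply: ge_sup => // _ [x /= x1 <-]; exact: fM. Qed.

Lemma op_norm_bound f (x : V) : rnorm (f x) <= op_norm f * rnorm x.
Proof.
have [->|x0] := eqVneq x 0; first by rewrite linear0 !rnorm0 mulr0.
have nx0 : 0 < rnorm x.
  by rewrite lt0r rnorm_ge0 andbT; apply: contraNneq x0 => /rnorm_eq0 ->.
rewrite -ler_pdivrMr// mulrC.
have rV : rnorm (((rnorm x)^-1)%:C : R[i]) = (rnorm x)^-1.
  by apply: complexI; rewrite -rnormE ger0_norm// ler0c invr_ge0 ltW.
rewrite -rV -rnormZ -linearZ; apply: op_norm_ub.
by rewrite rnormZ rV mulVf ?gt_eqF.
Qed.

Let normD (f g : blin) :
  (op_norm (f + g))%:C <= (op_norm f)%:C + (op_norm g)%:C :> R[i].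
Proof.
rewrite -rmorphD/= lecR; apply: op_norm_le => x x1.
by rewrite (le_trans (ler_rnormD _ _))// lerD// op_norm_ub.
Qed.

Let normZ (a : R[i]) (f : blin) :
  (op_norm (a *: f))%:C = `|a| * (op_norm f)%:C.
Proof.
have normZ_le b g : op_norm (b *: g) <= rnorm b * op_norm g.
  apply: op_norm_le => x x1; rewrite [(b *: g) x]/(b *: g x) rnormZ.
  by rewrite ler_wpM2l ?rnorm_ge0// op_norm_ub.
rewrite rnormE -rmorphM/=; congr (_%:C); apply/eqP; rewrite eq_le normZ_le/=.
have [->|a0] := eqVneq a 0.
  rewrite rnorm0 mul0r (le_trans (rnorm_ge0 ((0 *: f : blin) 0)))//.
  by rewrite op_norm_ub// rnorm0.
have na0 : 0 < rnorm a.
  by rewrite lt0r rnorm_ge0 andbT; apply: contraNneq a0 => /rnorm_eq0 ->.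
have naV : rnorm a^-1 = (rnorm a)^-1.
  apply: (mulfI (lt0r_neq0 na0)); rewrite -rnormM divff// divff ?gt_eqF//.
  by rewrite /rnorm normr1.
rewrite mulrC -ler_pdivlMr// mulrC -naV; apply: le_trans (normZ_le _ _).
by rewrite scalerA mulVf// scale1r.
Qed.

Let norm_eq0 (f : blin) : (op_norm f)%:C = 0 :> R[i] -> f = 0.
Proof.
move=> /complexI f0; apply/val_inj/funext => x; apply: rnorm_eq0.
by apply/eqP; rewrite eq_le rnorm_ge0 andbT; have := op_norm_bound f x;
  rewrite f0 mul0r.
Qed.

HB.instance Definition _ :=
  Lmodule_isNormed.Build R[i] blin normD normZ norm_eq0.

Lemma rnorm_blinE (f : blin) : rnorm f = op_norm f.
Proof. by []. Qed.

End blin.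
Arguments blin_fun {R} V W _.

Definition dual (R : realType) (V : normedModType R[i]) : normedModType R[i] :=
  blin V R[i]^o.

Section adjoint.
Context (R : realType) (V W : normedModType R[i]) (T : blin V W).

Lemma adjoint_subproof (phi : dual W) :
  (phi : W -> R[i]^o) \o T \in blin_fun V R[i]^o.
Proof.
apply/blin_funP; split=> [a u v /=|]; first by rewrite !linearP.
exists (op_norm phi * op_norm T) => x /=.
rewrite (le_trans (op_norm_bound _ _))// -mulrA ler_wpM2l ?op_norm_bound//.
by rewrite -rnorm_blinE rnorm_ge0.
Qed.

Definition adjoint_fun (phi : dual W) : dual V := Blin (adjoint_subproof phi).

Lemma adjoint_blin : adjoint_fun \in blin_fun (dual W) (dual V).
Proof.
apply/blin_funP; split=> [a phi psi|]; first exact/val_inj/funext.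
exists (op_norm T) => phi; apply: op_norm_le => x x1.
apply: le_trans (op_norm_bound phi _) _; rewrite mulrC.
by rewrite ler_wpM2r ?op_norm_ub// -rnorm_blinE rnorm_ge0.
Qed.

Definition adjoint : blin (dual W) (dual V) := Blin adjoint_blin.

End adjoint.

Definition is_eigenvalue (K : numFieldType) (V : lmodType K) (T : V -> V)
  (l : K) := exists2 v : V, v != 0 & T v = l *: v.

Definition typical (X : topologicalType) (P : set X) :=
  exists2 G : set X, Gdelta G /\ dense G & G `<=` P.

Section positive_contractions.
Context (R : realType) (q : R) (q1 : 1 <= q).
Local Notation X := (lq q1).

(* On R[i], 0 <= z says that z is real and nonnegative. *)
Definition positive_vec (x : X) := forall n, 0 <= x n.

Definition positive_op (T : blin X X) :=
  forall x, positive_vec x -> positive_vec (T x).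

Definition P1 : set (blin X X) := [set T | positive_op T /\ rnorm T <= 1].

Definition P1_op (T : P1) : blin X X := val T.

(* {ptws U -> V} carries the topology of pointwise convergence, here for the
   norm topologies of X and of its dual. *)
Definition P1_SOT :=
  initial_topology (fun T : P1 => (P1_op T : X -> X) : {ptws X -> X}).

Definition P1_SOTs := initial_topology (fun T : P1 =>
  ((P1_op T : X -> X) : {ptws X -> X},
   (adjoint (P1_op T) : dual X -> dual X) : {ptws dual X -> dual X})).

HB.instance Definition _ := Topological.on P1_SOT.
HB.instance Definition _ := Topological.on P1_SOTs.

End positive_contractions.
Arguments P1 {R q} q1.
Arguments P1_SOT {R q} q1.
Arguments P1_SOTs {R q} q1.

Lemma cvg_initialP (S : choiceType) (T : topologicalType) (f : S -> T)
    (F : set_system S) (s : S) : Filter F ->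
  F --> (s : initial_topology f) <-> f @ F --> f s.
Proof.
move=> FF; split=> [Fs|fFs A].
  apply: cvg_trans (@initial_continuous _ _ f s); exact: cvg_app.
rewrite nbhsE => -[_ [[B oB <-] Bs] BA]; apply: filterS BA _.
by apply: fFs; exact: open_nbhs_nbhs.
Qed.

Lemma cvg_ptwsP (U : Type) (T : topologicalType) (F : set_system (U -> T))
    (f : U -> T) : Filter F ->
  {ptws, F --> f} <-> forall u, g u @[g --> F] --> f u.
Proof.
by move=> FF; rewrite cvg_sup; split=> h u; have /cvg_initialP := h u.
Qed.

Section SOT_cvg.
Context (R : realType) (q : R) (q1 : 1 <= q).
Local Notation X := (lq q1).

Lemma cvg_SOTP (F : set_system (P1 q1)) (T : P1 q1) : Filter F ->
  F --> (T : P1_SOT q1) <->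
  forall x : X, P1_op S x @[S --> F] --> P1_op T x.
Proof. by move=> FF; rewrite cvg_initialP cvg_ptwsP. Qed.

Lemma cvg_SOTsP (F : set_system (P1 q1)) (T : P1 q1) : Filter F ->
  F --> (T : P1_SOTs q1) <->
  (forall x : X, P1_op S x @[S --> F] --> P1_op T x) /\
  (forall phi : dual X,
     adjoint (P1_op S) phi @[S --> F] --> adjoint (P1_op T) phi).
Proof.
move=> FF; rewrite cvg_initialP.
pose f (S : P1 q1) : {ptws X -> X} := P1_op S.
pose g (S : P1 q1) : {ptws dual X -> dual X} := adjoint (P1_op S).
split=> [FT|[F1 F2]].
  have F1 : f @ F --> f T.
    move=> A nA; apply: (FT (fst @^-1` A)); exists (A, setT) => [|[a b] []//].
    by split=> //; exact: filterT.
  have F2 : g @ F --> g T.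
    move=> A nA; apply: (FT (snd @^-1` A)); exists (setT, A) => [|[a b] []//].
    by split=> //; exact: filterT.
  split.
    by apply: (@cvg_ptwsP X X (f @ F) (f T) _).1.
  by apply: (@cvg_ptwsP (dual X) (dual X) (g @ F) (g T) _).1.
have G1 : f @ F --> f T by apply: (@cvg_ptwsP X X (f @ F) (f T) _).2.
have G2 : g @ F --> g T.
  by apply: (@cvg_ptwsP (dual X) (dual X) (g @ F) (g T) _).2.
move=> A [[B C] /= [nB nC] BCA].
have FB : F (f @^-1` B) := G1 B nB.
have FC : F (g @^-1` C) := G2 C nC.
have FA : F [set S | A (f S, g S)].
  by apply: filterS (filterI FB FC) => S [BS CS]; apply: BCA; split.
exact: FA.
Qed.

End SOT_cvg.

(* Main.v *)
Require Import Defs.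
From HB Require Import structures.
From mathcomp Require Import all_boot all_order all_algebra.
From mathcomp Require Import all_classical all_reals all_analysis.
From mathcomp Require Import borel_hierarchy.
From mathcomp Require Import complex.
From mathcomp Require Import ring lra zify.

Set Implicit Arguments.
Unset Strict Implicit.
Unset Printing Implicit Defensive.

Import Order.TTheory GRing.Theory Num.Theory.
Import numFieldNormedType.Exports.

Local Open Scope classical_set_scope.
Local Open Scope ring_scope.

(** If [T - l] has dense range, then an eigenvector of the adjoint of [T] for
    [l] vanishes on that range, hence is zero; dually, if [adjoint T - l] has
    dense range, or only a closed range containing the coordinate functionals,
    then [T] has no eigenvector for [l].  Eigenvalues of a contraction lie in
    the closed unit disc, so it is enough that all basis vectors [delta n]
    (for [T]) and all coordinate functionals [coordinate n] (for [adjoint T])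
    belong to these closed ranges for every [l] in the disc.  The operators
    with this property are the dense G_delta sets of the theorem.

    They are G_delta because the disc is compact: an approximate solution of
    [T y - l y = z] remains one for nearby [l] and [T], and finitely many
    solutions serve the whole disc ([open_dense_range]).

    They are dense for a constructive reason, which avoids Baire category.
    Let [T0] be a positive contraction, [P] the projection on the first [M]
    coordinates, [Q = 1 - P], [S] a positive contraction and [d] in ]0, 1[.
    Then [(1 - d) (P T0 P + Q S Q) + d S] is a positive contraction
    ([rnorm_perturb]), and it tends to [T0] when [M] grows and [d] tends to 0,
    for any choice of [S]: strongly ([rnorm_perturbB]) and, if [1 < q], strongly
    together with its adjoint ([rnorm_adjoint_perturbB]), since the norm of a
    functional on tails tends to 0 ([rnorm_dual_tail_lt]).  Here [S] moves
    blocks of [M] consecutive coordinates, and block 0 carries [P T0 P].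

    Modulo the closed range of [T - l], applying [T] amounts to multiplying
    by [l].  Along a chain [T (a (k+1)) = a k] this gives
    [a 0 = l a 1 = l^2 a 2 = ...], and [a 0] equals the mean of the first [J]
    terms.  For disjoint unit vectors that mean has norm of order
    [J^(1/q - 1)], and for coordinate functionals [J^(-1/q)], so for [1 < q] it
    tends to 0 and the chain lies in the closed range.

    - For the second assertion, the blocks are arranged as a bilateral chain
      through block 0.  The incoming half is handled by means, and membership
      then propagates through block 0 to the outgoing half
      ([bilateral_chain]); the adjoint runs the same chain backwards.
    - For the first assertion [q] may be 1 and the blocks form one chain ending
      in block 0.  If [|l| < 1], the terms [l^j a j] themselves tend to 0.  If
      [|l| = 1], the compression [(1 - d) P T0 P] is a strict contraction, so
      block 0 lies in the closed range, and from there the chain is recovered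
      by dividing by [l] ([unilateral_dense_range]). *)

(** * Norms on the sequence space *)

Section rnorm_extra.
Context (R : realType) (V : normedZmodType R[i]).
Implicit Types v w : V.

Lemma rnormN v : rnorm (- v) = rnorm v.
Proof. by rewrite /rnorm normrN. Qed.

Lemma rnormC v w : rnorm (v - w) = rnorm (w - v).
Proof. by rewrite -rnormN opprB. Qed.

Lemma ler_rnormB v w : rnorm (v - w) <= rnorm v + rnorm w.
Proof. by rewrite -(rnormN w); exact: ler_rnormD. Qed.

Lemma rnorm_le_eq0 v : (forall e : R, 0 < e -> rnorm v <= e) -> v = 0.
Proof.
move=> ve; apply: rnorm_eq0; apply/eqP; rewrite eq_le rnorm_ge0 andbT.
by apply/ler_addgt0Pl => e e0; rewrite addr0; exact: ve.
Qed.

End rnorm_extra.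

Section rnorm_scalar.
Context (R : realType).

Lemma rnorm_real (a : R) : rnorm (a%:C)%C = `|a|.
Proof.
by apply: complexI; rewrite -rnormE normc_def/= expr0n addr0 sqrtr_sqr.
Qed.

Lemma rnorm1 : rnorm (1 : R[i]) = 1.
Proof. by rewrite /rnorm normr1. Qed.

Lemma rnormX (a : R[i]) n : rnorm (a ^+ n) = rnorm a ^+ n.
Proof. by elim: n => [|n IH]; rewrite ?expr0 ?rnorm1// !exprS rnormM IH. Qed.

End rnorm_scalar.

Section division_by_successor.
Context (R : realFieldType).
Implicit Types a b e : R.

Lemma divD1_gt0 a e : 0 <= a -> 0 < e -> 0 < e / (a + 1).
Proof. by move=> a0 e0; rewrite divr_gt0// ltr_wpDl. Qed.

Lemma ler_mul_divD1 a b e : 0 <= a -> 0 < e -> b <= e / (a + 1) -> a * b <= e.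
Proof.
move=> a0 e0 be; apply: le_trans (ler_wpM2l a0 be) _.
by rewrite mulrCA ler_piMr ?(ltW e0)// ler_pdivrMr ?ltr_wpDl// mul1r lerDl.
Qed.

End division_by_successor.

Section lq_partial_sums.
Context (R : realType) (q : R) (q1 : 1 <= q).
Local Notation X := (lq q1).

Let q0 : 0 < q. Proof. exact: lt_le_trans q1. Qed.

Lemma le_powR_lq (a b : R) : 0 <= a -> 0 <= b -> (a `^ q <= b `^ q) = (a <= b).
Proof.
move=> a0 b0; apply/idP/idP => [|ab]; last first.
  by rewrite ge0_ler_powR ?nnegrE// ltW.
by apply: contraTT; rewrite -!ltNge => ba; rewrite gt0_ltr_powR.
Qed.

Lemma lq_partial_sum_le (x : X) N :
  \sum_(0 <= n < N) rnorm (x n) `^ q <= rnorm x `^ q.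
Proof.
rewrite -lee_fin -sumEFin -poweR_EFin rnorm_lqE -poweRrM mulVf ?gt_eqF//.
have s0 k : (0 <= (rnorm (x k) `^ q)%:E)%E by rewrite lee_fin powR_ge0.
by rewrite poweRe1 ?nneseries_ge0//; exact: nneseries_lim_ge.
Qed.

Lemma lq_mem_partial_sum (x : nat -> R[i]) (M : R) :
  (forall N, \sum_(0 <= n < N) rnorm (x n) `^ q <= M) -> x \in lq_fun q1.
Proof.
move=> xM; rewrite lq_funE lq_LnormE//; apply: poweR_lty.
apply: (@le_lt_trans _ _ M%:E); last exact: ltry.
apply: lime_le.
  by apply: is_cvg_nneseries => n _ _; rewrite lee_fin powR_ge0.
by apply: nearW => N; rewrite sumEFin lee_fin.
Qed.

Lemma rnorm_lq_le (x : X) (M : R) :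
  (forall N, \sum_(0 <= n < N) rnorm (x n) `^ q <= M) -> rnorm x `^ q <= M.
Proof.
move=> xM; rewrite -lee_fin -poweR_EFin rnorm_lqE -poweRrM mulVf ?gt_eqF//.
have s0 k : (0 <= (rnorm (x k) `^ q)%:E)%E by rewrite lee_fin powR_ge0.
rewrite poweRe1 ?nneseries_ge0//; apply: lime_le.
  by apply: is_cvg_nneseries => n _ _.
by apply: nearW => N; rewrite sumEFin lee_fin.
Qed.

Lemma rnorm_coord_le (x : X) n : rnorm (x n) <= rnorm x.
Proof.
rewrite -le_powR_lq ?rnorm_ge0//; apply: le_trans (lq_partial_sum_le x n.+1).
by rewrite big_nat_recr//= lerDr sumr_ge0// => *; exact: powR_ge0.
Qed.

End lq_partial_sums.

Lemma ler_sum_reindex (R : realDomainType) (a : nat -> R) (D : pred nat)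
    (f : nat -> nat) N : (forall n, 0 <= a n) -> injective f ->
  exists M, \sum_(0 <= n < N | D n) a (f n) <= \sum_(0 <= n < M) a n.
Proof.
move=> a0 fi; exists (\max_(n < N) f n).+1.
rewrite big_mkcond; apply: (@le_trans _ _ (\sum_(0 <= n < N) a (f n))).
  by apply: ler_sum => n _; case: ifP.
rewrite -(big_map f predT a); set s := map _ _.
have su : uniq s by rewrite map_inj_uniq// iota_uniq.
set t := index_iota _ _.
have st : {subset s <= t}.
  move=> k /mapP[n]; rewrite mem_index_iota => /andP[_ nN] ->.
  by rewrite mem_index_iota ltnS /= (leq_bigmax (Ordinal nN)).
rewrite [leRHS](bigID (mem s))/=.
have -> : \sum_(i <- t | i \in s) a i = \sum_(i <- s) a i.
  rewrite -big_filter; apply: perm_big; apply: uniq_perm => //.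
    by rewrite filter_uniq// iota_uniq.
  move=> k; rewrite mem_filter; apply/andP/idP => [[]//|ks].
  by split=> //; exact: st.
by rewrite lerDl sumr_ge0.
Qed.

Section lq_coordinates.
Context (R : realType) (q : R) (q1 : 1 <= q).
Implicit Types x y : lq q1.

Lemma lq0E n : (0 : lq q1) n = 0. Proof. by []. Qed.
Lemma lqDE x y n : (x + y) n = x n + y n. Proof. by []. Qed.
Lemma lqZE a x n : (a *: x) n = a * x n. Proof. by []. Qed.
Lemma lqP x y : (forall n, x n = y n) -> x = y.
Proof. by move=> xy; apply/val_inj/funext. Qed.

Lemma lq_sumE I (r : seq I) (P : pred I) (F : I -> lq q1) n :
  (\sum_(i <- r | P i) F i) n = \sum_(i <- r | P i) F i n.
Proof.
exact: (big_morph (fun x : lq q1 => x n) (fun x y => lqDE x y n) (lq0E n)).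
Qed.

End lq_coordinates.

Section blin_evaluation.
Context (R : realType) (V W : normedModType R[i]).
Implicit Types S T : blin V W.

Lemma blin0E v : (0 : blin V W) v = 0. Proof. by []. Qed.
Lemma blinDE S T v : (S + T) v = S v + T v. Proof. by []. Qed.
Lemma blinNE S v : (- S) v = - S v. Proof. by []. Qed.
Lemma blinZE a S v : (a *: S) v = a *: S v. Proof. by []. Qed.
Lemma blinP S T : (forall v, S v = T v) -> S = T.
Proof. by move=> xy; apply/val_inj/funext. Qed.

Lemma blin_bound S v : rnorm (S v) <= rnorm S * rnorm v.
Proof. exact: op_norm_bound. Qed.

Lemma blin_le S (M : R) : 0 <= M ->
  (forall v, rnorm (S v) <= M * rnorm v) -> rnorm S <= M.
Proof.
move=> M0 SM; apply: op_norm_le => v v1.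
by apply: le_trans (SM v) _; rewrite ler_piMr.
Qed.

Lemma contraction_le S v : rnorm S <= 1 -> rnorm (S v) <= rnorm v.
Proof.
by move=> S1; apply: le_trans (blin_bound S v) _; rewrite ler_piMl ?rnorm_ge0.
Qed.

End blin_evaluation.

Arguments blin_bound {R V W}.

Section blin_comp.
Context (R : realType) (U V W : normedModType R[i]).

Lemma blin_comp_subproof (S : blin V W) (T : blin U V) :
  S \o T \in blin_fun U W.
Proof.
apply/blin_funP; split=> [a u v /=|]; first by rewrite !linearP.
exists (rnorm S * rnorm T) => u /=; rewrite -mulrA.
by rewrite (le_trans (blin_bound _ _))// ler_wpM2l ?rnorm_ge0// blin_bound.
Qed.

Definition blin_comp S T : blin U W := Blin (blin_comp_subproof S T).


End blin_comp.

Section selection_operators.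
Context (R : realType) (q : R) (q1 : 1 <= q).
Local Notation X := (lq q1).
Implicit Types (x y : X) (D : pred nat).

Let q0 : 0 < q. Proof. exact: lt_le_trans q1. Qed.
Let pow0 : rnorm (0 : R[i]) `^ q = 0.
Proof. by rewrite rnorm0 powR0// gt_eqF. Qed.

(** One family for all coordinate operators: projections have [f] the identity,
    shifts have [D] everything. *)
Definition sel_fun D (f : nat -> nat) (x : nat -> R[i]) (n : nat) : R[i] :=
  if D n then x (f n) else 0.

Lemma sel_partial_sum D f x N : injective f ->
  \sum_(0 <= n < N) rnorm (sel_fun D f x n) `^ q <= rnorm x `^ q.
Proof.
move=> fi; have [M] := @ler_sum_reindex _ (fun n => rnorm (x n) `^ q) D f N
  (fun n => powR_ge0 _ _) fi.
move=> /le_trans/(_ (lq_partial_sum_le x M)); apply: le_trans.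
rewrite [leRHS]big_mkcond; apply: ler_sum => n _; rewrite /sel_fun.
by case: ifP => //; rewrite pow0.
Qed.

Section sel.
Variables (D : pred nat) (f : nat -> nat) (fi : injective f).

Lemma sel_mem x : sel_fun D f x \in lq_fun q1.
Proof. by apply: lq_mem_partial_sum => N; exact: sel_partial_sum. Qed.

Definition sel_vec x : X := Lq (sel_mem x).

Lemma rnorm_sel_vec x : rnorm (sel_vec x) <= rnorm x.
Proof.
rewrite -(le_powR_lq q1) ?rnorm_ge0//; apply: rnorm_lq_le => N.
exact: sel_partial_sum.
Qed.

Lemma sel_subproof : sel_vec \in blin_fun X X.
Proof.
apply/blin_funP; split=> [a x y|]; last first.
  by exists 1 => x; rewrite mul1r rnorm_sel_vec.
apply/lqP => n.
change (sel_fun D f (a *: x + y) n = a * sel_fun D f x n + sel_fun D f y n).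
rewrite /sel_fun lqDE lqZE.
by case: ifP; rewrite ?mulr0 ?addr0.
Qed.

Definition sel : blin X X := Blin sel_subproof.

Lemma selE x n : sel x n = if D n then x (f n) else 0.
Proof. by []. Qed.

Lemma rnorm_sel x : rnorm (sel x) <= rnorm x.
Proof. exact: rnorm_sel_vec. Qed.

End sel.

Definition proj D : blin X X := sel D (@inj_id nat).

Lemma projE D x n : proj D x n = if D n then x n else 0.
Proof. by []. Qed.

(** The two sums converge on different partial sums; they are passed to the
    limit one after the other. *)
Lemma rnorm_proj_split D x :
  rnorm (proj D x) `^ q + rnorm (proj (predC D) x) `^ q <= rnorm x `^ q.
Proof.
rewrite -lerBrDr; apply: rnorm_lq_le => N; rewrite lerBrDr addrC -lerBrDr.
apply: rnorm_lq_le => M; rewrite lerBrDr addrC.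
apply: le_trans (lq_partial_sum_le x (maxn N M)).
have mono y K : (K <= maxn N M)%N -> \sum_(0 <= n < K) rnorm (y n) `^ q <=
    \sum_(0 <= n < maxn N M) rnorm (y n) `^ q.
  move=> KM; rewrite (big_cat_nat (leq0n K) KM)//= lerDl sumr_ge0// => *.
  exact: powR_ge0.
apply: le_trans (lerD (mono _ _ (leq_maxl _ _)) (mono _ _ (leq_maxr _ _))) _.
rewrite -big_split; apply: ler_sum => n _; rewrite !projE /=.
by case: (D n); rewrite pow0 ?addr0 ?add0r.
Qed.

Lemma rnorm_disjointD x y : (forall n, x n = 0 \/ y n = 0) ->
  rnorm (x + y) `^ q <= rnorm x `^ q + rnorm y `^ q.
Proof.
move=> xy; apply: rnorm_lq_le => N.
apply: le_trans (lerD (lq_partial_sum_le x N) (lq_partial_sum_le y N)).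
rewrite -big_split; apply: ler_sum => n _; rewrite lqDE /=.
by case: (xy n) => ->; rewrite pow0 ?addr0 ?add0r.
Qed.

Definition trunc m := proj (fun n => n < m)%N.
Definition tail m := proj (fun n => m <= n)%N.

Lemma truncE m x n : trunc m x n = if (n < m)%N then x n else 0.
Proof. by []. Qed.

Lemma tailE m x n : tail m x n = if (m <= n)%N then x n else 0.
Proof. by []. Qed.

Lemma trunc_tail m x : trunc m x + tail m x = x.
Proof.
by apply/lqP => n; rewrite lqDE truncE tailE; case: ltnP; rewrite ?addr0 ?add0r.
Qed.

Lemma rnorm_trunc m x : rnorm (trunc m x) <= rnorm x.
Proof. exact: rnorm_sel. Qed.

Lemma rnorm_tail m x : rnorm (tail m x) <= rnorm x.
Proof. exact: rnorm_sel. Qed.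

Lemma rnorm_trunc_tail m x :
  rnorm (trunc m x) `^ q + rnorm (tail m x) `^ q <= rnorm x `^ q.
Proof.
apply: le_trans (rnorm_proj_split (fun n => n < m)%N x); rewrite lerD2l.
rewrite le_powR_lq ?rnorm_ge0//; suff -> : tail m x =
  proj (predC (fun n => n < m)%N) x by [].
by apply/lqP => n; rewrite tailE projE /= -leqNgt.
Qed.

Lemma tail_tail N m x : (N <= m)%N -> tail m x = tail m (tail N x).
Proof.
move=> Nm; apply/lqP => n; rewrite !tailE; case: (leqP m n) => // mn.
by rewrite (leq_trans Nm mn).
Qed.

Lemma tail_tailr N m x : (N <= m)%N -> tail m x = tail N (tail m x).
Proof.
move=> Nm; apply/lqP => n; rewrite !tailE; case: (leqP N n) => // nN.
by case: ifP => // mn; move: nN; rewrite ltnNge (leq_trans Nm mn).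
Qed.

(** If all tails had norm at least [e], every partial sum of the [q]-th powers
    would stay below [rnorm x `^ q - e `^ q], and so would their supremum
    [rnorm x `^ q]. *)
Lemma rnorm_tail_lt x (e : R) : 0 < e ->
  exists N, forall m, (N <= m)%N -> rnorm (tail m x) < e.
Proof.
move=> e0.
suff [N Ne] : exists N, rnorm (tail N x) < e.
  exists N => m Nm; rewrite (tail_tail _ Nm).
  by apply: le_lt_trans (rnorm_tail _ _) _.
apply: contrapT => /forallNP Ne.
have eq0 : 0 < e `^ q by exact: powR_gt0.
have : rnorm x `^ q <= rnorm x `^ q - e `^ q.
  apply: rnorm_lq_le => N; rewrite lerBrDr.
  apply: le_trans (rnorm_trunc_tail N x); apply: lerD; last first.
    by rewrite le_powR_lq ?rnorm_ge0 ?(ltW e0)// leNgt; apply/negP.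
  apply: le_trans (lq_partial_sum_le _ N); rewrite le_eqVlt; apply/orP; left.
  by apply/eqP; apply: eq_big_nat => n /andP[_ nN]; rewrite truncE nN.
by rewrite lerBrDr gerDl leNgt eq0.
Qed.

Let delta_partial_sum k N :
  \sum_(0 <= n < N) rnorm ((n == k)%:R : R[i]) `^ q <= 1.
Proof.
rewrite (eq_bigr (fun n => (n == k)%:R)); last first.
  by move=> n _; case: eqP; rewrite ?pow0// rnorm1 powR1.
rewrite -natr_sum lern1 -big_mkcond /= sum1_count.
by rewrite (@eq_count _ _ (pred1 k))// count_uniq_mem ?iota_uniq ?leq_b1.
Qed.

Lemma delta_mem k : (fun n => (n == k)%:R) \in lq_fun q1.
Proof. by apply: lq_mem_partial_sum => N; exact: delta_partial_sum. Qed.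

Definition delta k : X := Lq (delta_mem k).

Lemma deltaE k n : delta k n = (n == k)%:R. Proof. by []. Qed.

Lemma rnorm_delta k : rnorm (delta k) <= 1.
Proof.
rewrite -(le_powR_lq q1) ?rnorm_ge0// powR1; apply: rnorm_lq_le => N.
exact: delta_partial_sum.
Qed.

Lemma trunc_sum m x : trunc m x = \sum_(n < m) x n *: delta n.
Proof.
apply/lqP => k; rewrite lq_sumE truncE; case: ltnP => km.
  rewrite (bigD1 (Ordinal km))// big1 => [|i ik].
    by rewrite lqZE deltaE [nat_of_ord _]/= eqxx mulr1 /= addr0.
  rewrite lqZE deltaE -[k]/(nat_of_ord (Ordinal km)) val_eqE eq_sym.
  by rewrite (negPf ik) mulr0.
rewrite big1// => i _; rewrite lqZE deltaE gtn_eqF ?mulr0//.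
exact: leq_trans km.
Qed.

Lemma coordinate_subproof n : (fun x : X => x n : R[i]^o) \in blin_fun X R[i]^o.
Proof.
apply/blin_funP; split=> //; exists 1 => x; rewrite mul1r.
exact: rnorm_coord_le.
Qed.

Definition coordinate n : dual X := Blin (coordinate_subproof n).

Lemma coordinateE n x : coordinate n x = x n. Proof. by []. Qed.

End selection_operators.

(** * Approximate eigenvector equations and eigenvalues *)

Section closure_of_range.
Context (R : realType) (V : normedModType R[i]) (T : blin V V) (l : R[i]).

(** Membership in the closure of the range of [T - l]. *)
Definition in_closed_range (z : V) :=
  forall e : R, 0 < e -> exists y, rnorm (T y - l *: y - z) < e.

Lemma in_closed_range_image y : in_closed_range (T y - l *: y).
Proof. by move=> e e0; exists y; rewrite subrr rnorm0. Qed.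

Lemma in_closed_rangeD z w :
  in_closed_range z -> in_closed_range w -> in_closed_range (z + w).
Proof.
move=> hz hw e e0; have e20 : 0 < e / 2 by rewrite divr_gt0.
have [y hy] := hz _ e20; have [u hu] := hw _ e20; exists (y + u).
have -> : T (y + u) - l *: (y + u) - (z + w) =
    (T y - l *: y - z) + (T u - l *: u - w).
  by rewrite linearD scalerDr !opprD !addrA [LHS](ACl (1*3*5*2*4*6)).
by rewrite (le_lt_trans (ler_rnormD _ _))// (splitr e) ltrD.
Qed.

Lemma in_closed_rangeZ a z : in_closed_range z -> in_closed_range (a *: z).
Proof.
move=> hz e e0; have e20 : 0 < e / 2 by rewrite divr_gt0.
have [y hy] := hz _ (divD1_gt0 (rnorm_ge0 a) e20); exists (a *: y).
have -> : T (a *: y) - l *: (a *: y) - a *: z = a *: (T y - l *: y - z).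
  by rewrite linearZ/= !scalerBr !scalerA [a * l]mulrC.
rewrite rnormZ; have := ler_mul_divD1 (rnorm_ge0 a) e20 (ltW hy).
lra.
Qed.

Lemma in_closed_range0 : in_closed_range 0.
Proof.
by have := in_closed_range_image 0; rewrite linear0 scaler0 subrr.
Qed.

Lemma in_closed_rangeN z : in_closed_range z -> in_closed_range (- z).
Proof. by rewrite -scaleN1r; exact: in_closed_rangeZ. Qed.

Lemma in_closed_range_sum I (r : seq I) (P : pred I) (F : I -> V) :
  (forall i, P i -> in_closed_range (F i)) ->
  in_closed_range (\sum_(i <- r | P i) F i).
Proof.
move=> hF; apply: big_ind => //; first exact: in_closed_range0.
exact: in_closed_rangeD.
Qed.

Lemma in_closed_range_congr z w :
  in_closed_range (z - w) -> in_closed_range w -> in_closed_range z.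
Proof. by move=> hzw hw; rewrite -(subrK w z); exact: in_closed_rangeD. Qed.

Lemma in_closed_range_Zr a z :
  a != 0 -> in_closed_range (a *: z) -> in_closed_range z.
Proof.
by move=> a0 /(in_closed_rangeZ a^-1); rewrite scalerA mulVf// scale1r.
Qed.

(** Modulo the closed range, [z] agrees with vectors of arbitrarily small norm. *)
Lemma in_closed_range_small z :
  (forall e : R, 0 < e -> exists2 w, in_closed_range (z - w) & rnorm w < e) ->
  in_closed_range z.
Proof.
move=> hz e e0; have e20 : 0 < e / 2 by rewrite divr_gt0.
have [w hw we] := hz _ e20; have [y hy] := hw _ e20; exists y.
have -> : T y - l *: y - z = (T y - l *: y - (z - w)) - w.
  by rewrite opprB [w - z]addrC addrA addrK.
by rewrite (le_lt_trans (ler_rnormB _ _))// (splitr e) ltrD.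
Qed.

End closure_of_range.

Section eigenvalues.
Context (R : realType).

Lemma rnorm_adjoint (V W : normedModType R[i]) (T : blin V W) :
  rnorm (adjoint T) <= rnorm T.
Proof.
apply: blin_le => [|phi]; first exact: rnorm_ge0.
apply: blin_le => [|v]; first by rewrite mulr_ge0 ?rnorm_ge0.
apply: le_trans (blin_bound phi _) _.
have := ler_wpM2l (rnorm_ge0 phi) (blin_bound T v); rewrite /=; lra.
Qed.

Lemma eigenvalue_contraction (V : normedModType R[i]) (T : blin V V) l :
  rnorm T <= 1 -> is_eigenvalue T l -> rnorm l <= 1.
Proof.
move=> T1 [v v0 Tv]; have := contraction_le v T1.
rewrite Tv rnormZ ger_pMl// lt0r rnorm_ge0 andbT.
by apply: contraNneq v0 => /rnorm_eq0 ->.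
Qed.

Context (q : R) (q1 : 1 <= q).
Local Notation X := (lq q1).

Lemma dual_eq0 (phi : dual X) : (forall n, phi (delta q1 n) = 0) -> phi = 0.
Proof.
move=> phi0; apply: blinP => x; rewrite blin0E; apply: rnorm_le_eq0 => e e0.
have [N /(_ N (leqnn N)) hN] :=
  rnorm_tail_lt x (divD1_gt0 (rnorm_ge0 phi) e0).
rewrite -(trunc_tail N x) linearD trunc_sum linear_sum big1 ?add0r => [|i _].
  apply: le_trans (blin_bound phi _) _.
  exact: (ler_mul_divD1 (rnorm_ge0 _) e0 (ltW hN)).
by rewrite linearZ/= phi0 scaler0.
Qed.

(** An eigenvector of the adjoint annihilates the range of [T - l], hence its
    closure and every [delta q1 n]. *)
Lemma adjoint_no_eigenvalue (T : blin X X) : rnorm T <= 1 ->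
  (forall l, rnorm l <= 1 -> forall n, in_closed_range T l (delta q1 n)) ->
  forall l, ~ is_eigenvalue (adjoint T) l.
Proof.
move=> T1 hT l el; have l1 : rnorm l <= 1.
  apply: eigenvalue_contraction el; exact: le_trans (rnorm_adjoint T) T1.
case: el => phi /eqP + adj; apply; apply: dual_eq0 => n.
have phiT x : phi (T x) = l * phi x.
  by rewrite -[LHS]/(adjoint T phi x) adj.
apply: rnorm_le_eq0 => e e0.
have [y hy] := hT l l1 n _ (divD1_gt0 (rnorm_ge0 phi) e0).
have -> : phi (delta q1 n) = - phi (T y - l *: y - delta q1 n).
  by rewrite !linearB linearZ/= phiT subrr sub0r opprK.
rewrite rnormN; apply: le_trans (blin_bound phi _) _.
exact: (ler_mul_divD1 (rnorm_ge0 _) e0 (ltW hy)).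
Qed.

(** The functionals in the range of [adjoint T - l] vanish at an eigenvector
    of [T], and so do their limits, in particular all coordinates. *)
Lemma no_eigenvalue (T : blin X X) : rnorm T <= 1 ->
  (forall l, rnorm l <= 1 -> forall n,
     in_closed_range (adjoint T) l (coordinate q1 n)) ->
  forall l, ~ is_eigenvalue T l.
Proof.
move=> T1 hT l el; have l1 := eigenvalue_contraction T1 el.
case: el => x /eqP + Tx; apply; apply: lqP => n.
apply: rnorm_le_eq0 => e e0.
have [phi hphi] := hT l l1 n _ (divD1_gt0 (rnorm_ge0 x) e0).
pose psi : dual X := adjoint T phi - l *: phi - coordinate q1 n.
have -> : x n = - psi x.
  rewrite !blinDE !blinNE blinZE coordinateE -[adjoint T phi x]/(phi (T x)) Tx.
  by rewrite linearZ/= subrr sub0r opprK.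
rewrite rnormN; apply: le_trans (blin_bound psi x) _; rewrite mulrC.
exact: (ler_mul_divD1 (rnorm_ge0 _) e0 (ltW hphi)).
Qed.

End eigenvalues.

(** * Openness *)

Section rnorm_convergence.
Context (R : realType) (V : normedModType R[i]).

Lemma cvg_rnormP (T : Type) (F : set_system T) (FF : Filter F) (f : T -> V) v :
  f t @[t --> F] --> v <->
  forall e : R, 0 < e -> \forall t \near F, rnorm (v - f t) < e.
Proof.
split=> [/cvgrPdist_lt fv e e0|fv].
  have /fv : 0 < (e%:C)%C by rewrite ltcR.
  by apply: filterS => t; rewrite rnormE ltcR.
apply/cvgrPdist_lt => -[a b]; rewrite ltcE/= => /andP[/eqP b0 /fv].
by apply: filterS => t ht; rewrite rnormE ltcE/= b0 eqxx.
Qed.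

End rnorm_convergence.

Section disc.
Context (R : realType).

Definition disc : set (R * R) := [set p | rnorm (p.1 +i* p.2)%C <= 1].

Lemma rnorm_complex (a b : R) : rnorm (a +i* b)%C = Num.sqrt (a ^+ 2 + b ^+ 2).
Proof. by apply: complexI; rewrite -rnormE normc_def. Qed.

Lemma discE : disc = [set p | p.1 ^+ 2 + p.2 ^+ 2 <= 1].
Proof.
apply/seteqP; split => p; rewrite /disc /= rnorm_complex.
  by rewrite -{1}(sqrtr1 R) ler_sqrt.
by move=> h; rewrite -(sqrtr1 R) ler_sqrt.
Qed.

(** The scalars are parametrized by [R * R], where the disc is a closed part of
    a square. *)
Lemma compact_disc : compact disc.
Proof.
have cK : compact (`[(-1 : R), 1] `*` `[(-1 : R), 1]).
  by apply: compact_setX; exact: segment_compact.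
apply: subclosed_compact cK _; last first.
  rewrite discE => p /= h; have h1 := sqr_ge0 p.1; have h2 := sqr_ge0 p.2.
  by split; rewrite /= in_itv/=; apply/andP; split; nra.
rewrite discE.
have cf : continuous (fun p : R * R => p.1 ^+ 2 + p.2 ^+ 2).
  move=> p; apply: cvgD; rewrite expr2; apply: cvgM.
  - exact: cvg_fst.
  - exact: cvg_fst.
  - exact: cvg_snd.
  - exact: cvg_snd.
rewrite -[X in closed X]/((fun p : R * R => p.1 ^+ 2 + p.2 ^+ 2) @^-1`
  [set x | x <= 1]).
apply: closed_comp => [p _|]; last exact: closed_le.
exact: cf.
Qed.

Lemma rnorm_complex_le (a b : R) : rnorm (a +i* b)%C <= `|a| + `|b|.
Proof.
rewrite rnorm_complex -[leRHS]ger0_norm ?addr_ge0// -sqrtr_sqr.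
rewrite ler_sqrt ?sqr_ge0//.
rewrite sqrrD !real_normK ?num_real//; have := normr_ge0 a; have := normr_ge0 b.
nra.
Qed.

End disc.

Section open_range.
Context (R : realType) (V : normedModType R[i]) (Z : topologicalType).
Variable (F : Z -> blin V V).
Hypothesis cF : forall t v, F s v @[s --> t] --> F t v.

(** A vector [y] that works for [F t] and [l] works for all nearby parameters;
    compactness of the disc makes the neighbourhood of [t] independent of [l]. *)
Lemma open_dense_range (z : V) (e : R) :
  open [set t | forall l, rnorm l <= 1 ->
    exists y, rnorm (F t y - l *: y - z) < e].
Proof.
rewrite openE => t /= ht; have /compact_near_coveringP ncov := @compact_disc R.
have : \forall s \near t, @disc R `<=` (fun p => exists y,
    rnorm (F s y - (p.1 +i* p.2)%C *: y - z) < e).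
  apply: ncov => p /ht[y hy].
  set d := e - rnorm (F t y - (p.1 +i* p.2)%C *: y - z).
  have d0 : 0 < d by rewrite subr_gt0.
  have d1 : 0 < d / (2 * (rnorm y + 1)).
    by rewrite divr_gt0// mulr_gt0// ltr_wpDl ?rnorm_ge0.
  have d2 : 0 < d / 2 by rewrite divr_gt0.
  have h1 : \forall s \near t, rnorm (F t y - F s y) < d / 2.
    by move: (@cF t y) => /cvg_rnormP; exact.
  have h2 : \forall p' \near p, rnorm ((p'.1 +i* p'.2) - (p.1 +i* p.2))%C <
      d / (2 * (rnorm y + 1)).
    set r := d / _ in d1 *.
    have r2 : 0 < r / 2 by rewrite divr_gt0.
    exists (ball p.1 (r / 2), ball p.2 (r / 2)).
      by split; exact: nbhsx_ballx.
    move=> [a b] /= [pa pb].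
    rewrite (_ : _ - _ = ((a - p.1) +i* (b - p.2))%C)//.
    apply: le_lt_trans (rnorm_complex_le _ _) _; rewrite (splitr r).
    by rewrite ltrD// distrC.
  near=> p' s => /=; exists y.
  (* both perturbations, of the operator and of the scalar, cost at most d / 2 *)
  have -> : F s y - (p'.1 +i* p'.2)%C *: y - z =
      (F t y - (p.1 +i* p.2)%C *: y - z) - ((F t y - F s y) +
        ((p'.1 +i* p'.2) - (p.1 +i* p.2))%C *: y).
    rewrite scalerBl !opprD !opprK !addrA.
    by rewrite [RHS](ACl (5*6*3*(1*4)*(2*7)))/= subrr addNr !addr0.
  apply: le_lt_trans (ler_rnormB _ _) _; rewrite -ltrBrDl -/d.
  apply: le_lt_trans (ler_rnormD _ _) _; rewrite (splitr d) ltr_leD//.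
    by near: s.
  rewrite rnormZ; apply: le_trans (_ : d / (2 * (rnorm y + 1)) * rnorm y <= _).
    by rewrite ler_wpM2r ?rnorm_ge0// ltW//; near: p'.
  rewrite invfM mulrA -mulrA ler_piMr ?(ltW d2)// mulrC.
  rewrite ler_pdivrMr ?mul1r ?lerDl//.
  by rewrite ltr_wpDl ?rnorm_ge0.
rewrite /interior; apply: filterS => s hs l l1.
have [|y hy] := hs (complex.Re l, complex.Im l).
  by rewrite /disc/=; case: l l1.
by exists y; case: l l1 hy.
Unshelve. all: by end_near. Qed.

End open_range.

(** * Tails of functionals *)

Section dual_tail.
Context (R : realType) (q : R) (q1 : 1 <= q).
Local Notation X := (lq q1).

Lemma exists_phase (z : R[i]) :
  exists2 a : R[i], rnorm a <= 1 & a * z = ((rnorm z)%:C)%C.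
Proof.
have [->|z0] := eqVneq z 0; first by exists 0; rewrite ?rnorm0 ?mulr0.
exists ((rnorm z)%:C%C / z); last by rewrite divfK.
rewrite rnormM rnorm_real ger0_norm ?rnorm_ge0//.
have nz : rnorm z != 0 by apply: contraNneq z0 => /rnorm_eq0 ->.
by rewrite -(mulfK nz (rnorm z^-1)) -rnormM mulVf// rnorm1 mul1r divff.
Qed.

Lemma exists_almost_norming (V : normedModType R[i]) (phi : dual V) (c : R) :
  c < rnorm phi -> exists2 v, rnorm v <= 1 & c < rnorm (phi v).
Proof.
move=> cphi; apply: contrapT => h; move: cphi; rewrite ltNge => /negP; apply.
apply: op_norm_le => v v1; rewrite leNgt; apply/negP => cv; apply: h.
by exists v.
Qed.

(** Let [c] be the infimum of the norms of [phi] on the tails.  Beyond any [N]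
    there are two disjointly supported vectors of norm at most 1 at which [phi]
    is almost [c]; their sum has norm at most [2 `^ q^-1] and [phi] is almost
    [2 * c] there.  Hence all these norms are at least [2 * c / 2 `^ q^-1], which
    exceeds [c] when [1 < q], unless [c = 0]. *)
Lemma rnorm_dual_tail_lt (phi : dual X) (e : R) : 1 < q -> 0 < e ->
  exists N, forall m, (N <= m)%N -> rnorm (adjoint (tail q1 m) phi) < e.
Proof.
move=> q2 e0; have q0 : 0 < q by exact: lt_trans q2.
pose a m := rnorm (adjoint (tail q1 m) phi).
have aE m x : rnorm (phi (tail q1 m x)) <= a m * rnorm x.
  exact: (blin_bound (adjoint (tail q1 m) phi) x).
have a0 m : 0 <= a m by exact: rnorm_ge0.
suff [N aN] : exists N, a N < e.
  exists N => m Nm; apply: le_lt_trans aN; apply: blin_le => // x.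
  rewrite -[adjoint _ _ x]/(phi (tail q1 m x)) (tail_tailr x Nm).
  apply: le_trans (aE _ _) _; apply: ler_wpM2l => //; exact: rnorm_tail.
apply: contrapT => /forallNP ae.
have {}ae N : e <= a N by rewrite leNgt; apply/negP.
have ha : has_inf (range a).
  by split; [exists (a 0%N); exists 0%N|exists e => _ [N _ <-]].
pose c := inf (range a).
have ca N : c <= a N by apply: ge_inf; [case: ha|exists N].
have c0 : 0 < c.
  apply: lt_le_trans e0 _.
  by apply: lb_le_inf => [|_ [N _ <-]]; first by case: ha.
pose s : R := 2 `^ q^-1.
have sq : s `^ q = 2 by rewrite -powRrM mulVf ?gt_eqF// powRr1.
have s1 : 0 < s by exact: powR_gt0.
have s2 : s < 2.
  rewrite ltNge; apply/negP => s2; have : 2 `^ q <= s `^ q.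
    by rewrite le_powR_lq// ltW.
  have : 1 `^ (q - 1) < 2 `^ (q - 1) :> R.
    by apply: gt0_ltr_powR; rewrite ?subr_gt0 ?nnegrE// ltr1n.
  rewrite powR1 sq -(@mulr_powRB1 _ 2 q)// => h h'; lra.
suff : forall N, 2 * c / s <= a N.
  move=> h; have : 2 * c / s <= c.
    by apply: lb_le_inf => [|_ [N _ <-]] //; case: ha.
  by rewrite ler_pdivrMr// mulrC ler_pM2l// leNgt s2.
move=> N; rewrite ler_pdivrMr//; apply/ler_addgt0Pl => e1 e10.
have e4 : 0 < e1 / 4 by rewrite divr_gt0.
have ace m : c - e1 / 4 < a m by apply: lt_le_trans (ca m); rewrite gtrBl.
have [u u1 hu] := exists_almost_norming (ace N).
have [M /(_ (maxn N M) (leq_maxr _ _)) hM] :=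
  rnorm_tail_lt u (divD1_gt0 (rnorm_ge0 phi) e4).
set K := maxn N M in hM; have NK : (N <= K)%N := leq_maxl _ _.
have [v v1 hv] := exists_almost_norming (ace K).
(* cutting u at K makes its support disjoint from that of v' *)
pose u' := trunc q1 K (tail q1 N u); pose v' := tail q1 K v.
have hu' : c - e1 / 2 <= rnorm (phi u').
  have : rnorm (phi (tail q1 N u)) <= rnorm (phi u') + e1 / 4.
    rewrite -[X in phi X](trunc_tail K) linearD -(tail_tail _ NK).
    apply: le_trans (ler_rnormD _ _) _; rewrite lerD2l.
    apply: le_trans (blin_bound phi _) _.
    exact: (ler_mul_divD1 (rnorm_ge0 _) e4 (ltW hM)).
  rewrite -[adjoint _ _ u]/(phi (tail q1 N u)) in hu.
  lra.
rewrite -[adjoint _ _ v]/(phi v') in hv.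
(* after rotation the values of phi at both vectors are nonnegative and add up *)
have [al al1 hal] := exists_phase (phi u').
have [be be1 hbe] := exists_phase (phi v').
pose w := al *: u' + be *: v'.
have phiw : rnorm (phi w) = rnorm (phi u') + rnorm (phi v').
  rewrite linearD !linearZ/= -![_ *: _]/(_ * _) hal hbe -rmorphD/= rnorm_real.
  by rewrite ger0_norm// addr_ge0 ?rnorm_ge0.
have ws : rnorm w <= s.
  rewrite -(le_powR_lq q1) ?rnorm_ge0 ?(ltW s1)// sq.
  apply: le_trans (rnorm_disjointD _) _.
    move=> n; rewrite !lqZE /u' /v' truncE (tailE K).
    by case: ltnP; [right|left]; rewrite mulr0.
  have unit_pow (b : R[i]) (y : X) : rnorm b <= 1 -> rnorm y <= 1 ->
      rnorm (b *: y) `^ q <= 1.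
    move=> b1 y1; apply: (@le_trans _ _ (1 `^ q)); last by rewrite powR1.
    rewrite le_powR_lq ?rnorm_ge0//.
    by rewrite rnormZ mulr_ile1 ?rnorm_ge0.
  rewrite -[leRHS]/(1 + 1) lerD// unit_pow//.
    by rewrite (le_trans (rnorm_trunc _ _))// (le_trans (rnorm_tail _ _)).
  by rewrite (le_trans (rnorm_tail _ _)).
have wN : w = tail q1 N w.
  apply/lqP => n; rewrite tailE; case: leqP => // nN.
  have nK := leq_trans nN NK; rewrite lqDE !lqZE /u' /v' truncE !tailE.
  by rewrite nK (leqNgt N) nN (leqNgt K) nK !mulr0 addr0.
have : rnorm (phi w) <= a N * s.
  rewrite wN; apply: le_trans (aE N w) _; exact: ler_wpM2l.
lra.
Qed.

End dual_tail.

(** * Perturbing a contraction *)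

Section perturbation.
Context (R : realType) (q : R) (q1 : 1 <= q).
Local Notation X := (lq q1).
Local Notation P := (trunc q1).
Local Notation Q := (tail q1).
Implicit Types (S T : blin X X) (x : X) (m : nat) (d : R).

Let q0 : 0 < q. Proof. exact: lt_le_trans q1. Qed.

Definition block_sum m T S : blin X X :=
  blin_comp (P m) (blin_comp T (P m)) + blin_comp (Q m) (blin_comp S (Q m)).

Lemma block_sumE m T S x :
  block_sum m T S x = P m (T (P m x)) + Q m (S (Q m x)).
Proof. by []. Qed.

(** For [d] in the unit interval, a convex combination of two contractions,
    close to [T] when [m] is large and [d] is small, whatever [S] is. *)
Definition perturb d m T S : blin X X :=
  ((1 - d)%:C)%C *: block_sum m T S + (d%:C)%C *: S.

Lemma perturbE d m T S x : perturb d m T S x =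
  ((1 - d)%:C)%C *: (P m (T (P m x)) + Q m (S (Q m x))) + (d%:C)%C *: S x.
Proof. by []. Qed.

Lemma rnorm_block_sum m T S x : rnorm T <= 1 -> rnorm S <= 1 ->
  rnorm (block_sum m T S x) <= rnorm x.
Proof.
move=> T1 S1; rewrite -(le_powR_lq q1) ?rnorm_ge0// block_sumE.
apply: le_trans (rnorm_disjointD _) _.
  by move=> n; rewrite truncE tailE; case: ltnP; [right|left].
apply: le_trans (rnorm_trunc_tail m x); apply: lerD.
  rewrite le_powR_lq ?rnorm_ge0//.
  by apply: le_trans (rnorm_trunc _ _) _; exact: contraction_le.
rewrite le_powR_lq ?rnorm_ge0//.
by apply: le_trans (rnorm_tail _ _) _; exact: contraction_le.
Qed.

Lemma rnorm_perturb d m T S : 0 <= d <= 1 -> rnorm T <= 1 -> rnorm S <= 1 ->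
  rnorm (perturb d m T S) <= 1.
Proof.
move=> /andP[d0 d1] T1 S1; apply: blin_le => // x.
rewrite mul1r; apply: le_trans (ler_rnormD _ _) _.
rewrite !rnormZ !rnorm_real !ger0_norm ?subr_ge0//.
have h1 := rnorm_block_sum m x T1 S1; have h2 := contraction_le x S1.
apply: le_trans (lerD (ler_wpM2l _ h1) (ler_wpM2l d0 h2)) _.
  by rewrite subr_ge0.
by rewrite -mulrDl subrK mul1r.
Qed.

Lemma positive_sel D (f : nat -> nat) (fi : injective f) :
  positive_op (sel q1 D fi).
Proof. by move=> x x0 n; rewrite selE; case: ifP. Qed.

Lemma positive_perturb d m T S : 0 <= d <= 1 ->
  positive_op T -> positive_op S -> positive_op (perturb d m T S).
Proof.
move=> /andP[d0 d1] T0 S0 x x0 n.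
have P0 y : positive_vec y -> positive_vec (P m y) by exact: positive_sel.
have Q0 y : positive_vec y -> positive_vec (Q m y) by exact: positive_sel.
rewrite perturbE lqDE !lqZE lqDE addr_ge0 ?mulr_ge0 ?ler0c ?subr_ge0//.
- by rewrite addr_ge0//; [exact/P0/T0/P0|exact/Q0/S0/Q0].
- exact: S0.
Qed.

(** In each of the first three terms a tail projection occurs, on the side where
    it acts on [x] or on the side where a functional sees it. *)
Lemma perturbB d m T S x : perturb d m T S x - T x =
  Q m (S (Q m x)) - T (Q m x) - Q m (T (P m x)) +
  (d%:C)%C *: (S x - block_sum m T S x).
Proof.
have -> : T x = P m (T (P m x)) + Q m (T (P m x)) + T (Q m x).
  by rewrite trunc_tail -linearD trunc_tail.
rewrite perturbE block_sumE.
set a := P m (T _); set b := Q m (S _); set c := S x; set e := Q m (T _).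
set f := T _; set D := (d%:C)%C.
rewrite rmorphB rmorph1 scalerBl scale1r scalerBr.
rewrite !opprD !addrA -/D.
by rewrite [LHS](ACl (2*7*6*4*3*(1*5)))/= subrr addr0.
Qed.

Lemma rnorm_perturb_shift d m T S x : 0 <= d -> rnorm T <= 1 -> rnorm S <= 1 ->
  rnorm ((d%:C)%C *: (S x - block_sum m T S x)) <= d * (2 * rnorm x).
Proof.
move=> d0 T1 S1; rewrite rnormZ rnorm_real ger0_norm// ler_wpM2l//.
rewrite mulr_natl mulr2n; apply: le_trans (ler_rnormB _ _) _.
by rewrite lerD ?rnorm_block_sum// contraction_le.
Qed.

Lemma rnorm_perturbB d m T S x : 0 <= d -> rnorm T <= 1 -> rnorm S <= 1 ->
  rnorm (perturb d m T S x - T x) <=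
  3 * rnorm (Q m x) + rnorm (Q m (T x)) + d * (2 * rnorm x).
Proof.
move=> d0 T1 S1; rewrite perturbB; apply: le_trans (ler_rnormD _ _) _.
apply: lerD; last exact: rnorm_perturb_shift.
(* the tail of T (P m x) is not yet small; that of the fixed vector T x is *)
have -> : T (P m x) = T x - T (Q m x).
  by apply/eqP; rewrite eq_sym subr_eq -linearD trunc_tail.
rewrite linearB; apply: le_trans (ler_rnormB _ _) _.
apply: le_trans (lerD (ler_rnormB _ _) (ler_rnormB _ _)) _.
have h1 := rnorm_tail m (S (Q m x)); have h2 := contraction_le (Q m x) S1.
have h3 := rnorm_tail m (T (Q m x)); have h4 := contraction_le (Q m x) T1.
lra.
Qed.

Lemma rnorm_adjoint_perturbB d m T S (phi : dual X) : 0 <= d ->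
  rnorm T <= 1 -> rnorm S <= 1 ->
  rnorm (adjoint (perturb d m T S) phi - adjoint T phi) <=
  2 * rnorm (adjoint (Q m) phi) + rnorm (adjoint (Q m) (adjoint T phi)) +
  d * (2 * rnorm phi).
Proof.
move=> d0 T1 S1; apply: blin_le => [|x].
  have h0 := rnorm_ge0 phi; have h1 := rnorm_ge0 (adjoint (Q m) phi).
  have h2 := rnorm_ge0 (adjoint (Q m) (adjoint T phi)).
  by rewrite addr_ge0 ?mulr_ge0// addr_ge0// mulr_ge0.
have phiE (a b c e : X) : phi (a - b - c + e) = phi a - phi b - phi c + phi e.
  by rewrite linearD !linearB.
rewrite -[X in rnorm X]/(phi (perturb d m T S x) - phi (T x)).
have -> : phi (perturb d m T S x) - phi (T x) = phi (perturb d m T S x - T x).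
  by move: (perturb d m T S x) (T x) => y z; rewrite linearB.
rewrite perturbB phiE.
have Qb (psi : dual X) y : rnorm (psi (Q m y)) <=
    rnorm (adjoint (Q m) psi) * rnorm y.
  exact: (blin_bound (adjoint (Q m) psi) y).
apply: le_trans (ler_rnormD _ _) _; rewrite mulrDl; apply: lerD; last first.
  apply: le_trans (blin_bound phi ((d%:C)%C *: (S x - block_sum m T S x))) _.
  have := ler_wpM2l (rnorm_ge0 phi) (rnorm_perturb_shift m x d0 T1 S1).
  lra.
apply: le_trans (ler_rnormB _ _) _.
apply: le_trans (lerD (ler_rnormB _ _) (lexx _)) _.
have h1 := Qb phi (S (Q m x)); have h2 := Qb phi (T (P m x)).
have h3 := Qb (adjoint T phi) x.
rewrite -[adjoint T _ _]/(phi (T (Q m x))) in h3.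
have h4 : rnorm (S (Q m x)) <= rnorm x.
  by apply: le_trans (contraction_le _ S1) _; exact: rnorm_tail.
have h5 : rnorm (T (P m x)) <= rnorm x.
  by apply: le_trans (contraction_le _ T1) _; exact: rnorm_trunc.
have h6 := ler_wpM2l (rnorm_ge0 (adjoint (Q m) phi)) h4.
have h7 := ler_wpM2l (rnorm_ge0 (adjoint (Q m) phi)) h5.
lra.
Qed.

End perturbation.

(** * Chains of vectors *)

Section chains.
Context (R : realType) (V : normedModType R[i]) (T : blin V V) (l : R[i]).
Local Notation inR := (in_closed_range T l).

(** Modulo the closed range [T] is multiplication by [l], so
    [a k = T (a k.+1)] agrees with [l *: a k.+1]. *)
Lemma in_closed_range_power (a : nat -> V) j :
  (forall k, T (a k.+1) = a k) -> inR (a 0%N - l ^+ j *: a j).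
Proof.
move=> Ta; elim: j => [|j IH].
  by rewrite expr0 scale1r subrr; exact: in_closed_range0.
rewrite -(subrKA (l ^+ j *: a j)); apply: in_closed_rangeD => //.
rewrite exprSr -scalerA -scalerBr; apply: in_closed_rangeZ.
by rewrite -{1}Ta; exact: in_closed_range_image.
Qed.

(** All [l ^+ j *: a j] agree with [a 0] modulo the closed range, hence so does
    their mean, which can be much smaller than its terms. *)
Lemma in_closed_range_average (a : nat -> V) :
  (forall k, T (a k.+1) = a k) ->
  (forall e : R, 0 < e -> exists J : nat,
     rnorm (J.+1%:R^-1 *: \sum_(j < J.+1) l ^+ j *: a j) < e) ->
  inR (a 0%N).
Proof.
move=> Ta ha; apply: in_closed_range_small => e /ha[J hJ].
exists (J.+1%:R^-1 *: \sum_(j < J.+1) l ^+ j *: a j) => //.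
have -> : a 0%N = J.+1%:R^-1 *: \sum_(j < J.+1) a 0%N.
  rewrite sumr_const card_ord -(scaler_nat _ (a 0%N)) scalerA.
  by rewrite mulVf ?scale1r// pnatr_eq0.
rewrite -scalerBr -sumrB; apply: in_closed_rangeZ; apply: in_closed_range_sum.
by move=> j _; exact: in_closed_range_power.
Qed.

(** The operator moves [a 1 -> a 0 -> c -> b 0 -> b 1], with weight [d] on both
    sides of [c] and an error [w] spanned by the [c]s.  The closed range is
    stable under [T], so membership travels along the arrows. *)
Lemma bilateral_chain (d : R[i]) (M : nat) (a b : nat -> nat -> V)
    (c w : nat -> V) :
  d != 0 ->
  (forall r k, (r < M)%N -> inR (a k r)) ->
  (forall r, (r < M)%N -> T (a 0%N r) = d *: c r) ->
  (forall r, (r < M)%N -> T (c r) = w r + d *: b 0%N r) ->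
  ((forall r, (r < M)%N -> inR (c r)) -> forall r, (r < M)%N -> inR (w r)) ->
  (forall r k, (r < M)%N -> T (b k r) = b k.+1 r) ->
  forall r, (r < M)%N -> inR (c r) /\ forall k, inR (b k r).
Proof.
move=> d0 ha Ta Tc hw Tb.
have hc r : (r < M)%N -> inR (c r).
  move=> rM; apply: (in_closed_range_Zr d0); rewrite -Ta//.
  apply: in_closed_range_congr (in_closed_rangeZ l (ha r 0%N rM)).
  exact: in_closed_range_image.
move=> r rM; split; first exact: hc.
elim=> [|k IH].
  apply: (in_closed_range_Zr d0).
  have -> : d *: b 0%N r = T (c r) - l *: c r + (l *: c r - w r).
    by rewrite Tc// addrA subrK addrC addKr.
  apply: in_closed_rangeD; first exact: in_closed_range_image.
  apply: in_closed_rangeD; first by apply: in_closed_rangeZ; exact: hc.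
  by apply: in_closed_rangeN; exact: hw.
rewrite -Tb//; apply: in_closed_range_congr (in_closed_rangeZ l IH).
exact: in_closed_range_image.
Qed.

End chains.

Section averages.
Context (R : realType) (q : R) (q1 : 1 <= q).
Local Notation X := (lq q1).

Let q0 : 0 < q. Proof. exact: lt_le_trans q1. Qed.

Lemma rnorm_natV n : rnorm (n%:R^-1 : R[i]) = n%:R^-1.
Proof.
rewrite -(rmorph_nat (real_complex R)) -fmorphV.
by rewrite rnorm_real ger0_norm// invr_ge0.
Qed.

Lemma rnorm_sum_delta (u : nat -> nat) (z : nat -> R[i]) J :
  injective u -> (forall j, rnorm (z j) <= 1) ->
  rnorm (\sum_(j < J) z j *: delta q1 (u j)) `^ q <= J%:R.
Proof.
move=> ui z1; elim: J => [|J IH].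
  by rewrite big_ord0 rnorm0 powR0 ?gt_eqF.
rewrite big_ord_recr/= -natr1; apply: le_trans (rnorm_disjointD _) _.
  move=> n; have [->|nu] := eqVneq n (u J); [left|right].
    rewrite lq_sumE big1// => i _; rewrite lqZE deltaE (inj_eq ui).
    by rewrite gtn_eqF ?mulr0.
  by rewrite lqZE deltaE (negPf nu) mulr0.
apply: lerD => //; apply: (@le_trans _ _ (1 `^ q)); last by rewrite powR1.
rewrite le_powR_lq ?rnorm_ge0// rnormZ mulr_ile1 ?rnorm_ge0//.
exact: rnorm_delta.
Qed.

(** The [J] disjoint terms have total norm at most [J `^ q^-1], which is
    negligible against [J] because [1 < q]. *)
Lemma average_delta (u : nat -> nat) (z : nat -> R[i]) (e : R) : 1 < q ->
  injective u -> (forall j, rnorm (z j) <= 1) -> 0 < e ->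
  exists J : nat,
    rnorm (J.+1%:R^-1 *: \sum_(j < J.+1) z j *: delta q1 (u j)) < e.
Proof.
move=> q2 ui z1 e0; have p0 : 0 < q - 1 by rewrite subr_gt0.
(* the bound on the mean is below e as soon as J `^ (q - 1) exceeds e `^ - q *)
pose B := (e `^ q)^-1 `^ (q - 1)^-1.
have eq0 : 0 < e `^ q by exact: powR_gt0.
have B0 : 0 <= B by exact: powR_ge0.
have BE : B `^ (q - 1) = (e `^ q)^-1.
  by rewrite -powRrM mulVf ?gt_eqF// powRr1// invr_ge0 ltW.
exists (Num.truncn B); set J := (Num.truncn B).+1.
have BJ : B < J%:R by rewrite /J; have /andP[] := truncn_itv B0.
have J0 : 0 < J%:R :> R by rewrite ltr0n.
rewrite rnormZ rnorm_natV mulrC ltr_pdivrMr// ltNge; apply/negP => h.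
have : (e * J%:R) `^ q <= J%:R.
  apply: le_trans (rnorm_sum_delta J ui z1).
  by rewrite le_powR_lq ?rnorm_ge0// mulr_ge0// ltW.
rewrite powRM ?(ltW e0) ?(ltW J0)// -(@mulr_powRB1 _ J%:R q) ?(ltW J0)//.
rewrite mulrCA ger_pMr// leNgt; apply/negP; rewrite negbK.
rewrite -ltr_pdivrMl// mulr1 -BE; apply: gt0_ltr_powR => //.
by rewrite nnegrE ltW.
Qed.

(** On the unit ball the [q]-th powers of the coordinates have sum at most 1, so
    the inequality [t <= h + C * t `^ q] bounds the sum of the first [J]
    coordinates by [J * h + C], and [h] is arbitrary. *)
Lemma average_coordinate (u : nat -> nat) (z : nat -> R[i]) (e : R) :
  injective u -> (forall j, rnorm (z j) <= 1) -> 0 < e ->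
  exists J : nat,
    rnorm (J.+1%:R^-1 *: \sum_(j < J.+1) z j *: coordinate q1 (u j)) < e.
Proof.
move=> ui z1 e0; pose h := e / 3; have h0 : 0 < h by rewrite divr_gt0.
pose C := (h `^ (q - 1))^-1; have C0 : 0 < C by rewrite invr_gt0 powR_gt0.
have young t : 0 <= t -> t <= h + C * t `^ q.
  move=> t0; case: (leP t h) => [th|ht].
    by rewrite (le_trans th)// lerDl mulr_ge0 ?powR_ge0// ltW.
  apply: (@le_trans _ _ (C * t `^ q)); last by rewrite lerDr ltW.
  rewrite -mulr_powRB1// ler_pdivlMl ?powR_gt0// mulrC ler_wpM2l//.
  by apply: ge0_ler_powR; rewrite ?subr_ge0 ?nnegrE// ltW.
exists (Num.truncn (C / h)); set J := (Num.truncn (C / h)).+1.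
have BJ : C / h < J%:R.
  by rewrite /J; have /andP[] := truncn_itv (ltW (divr_gt0 C0 h0)).
have J0 : 0 < J%:R :> R by rewrite ltr0n.
apply: (@le_lt_trans _ _ (2 * h)); last by rewrite /h; lra.
apply: op_norm_le => x x1.
rewrite -[X in rnorm X]/(J%:R^-1 * (\sum_(j < J) z j *: coordinate q1 (u j)) x).
rewrite rnormM rnorm_natV mulrC ler_pdivrMr//.
have -> : (\sum_(j < J) z j *: coordinate q1 (u j)) x =
    \sum_(j < J) z j * x (u j).
  exact: (big_morph (fun f : dual X => f x)
    (fun f g => blinDE f g x) (blin0E _ x)).
have sumle : \sum_(j < J) rnorm (x (u j)) `^ q <= 1.
  apply: (@le_trans _ _ (1 `^ q)); last by rewrite powR1.
  apply: (@le_trans _ _ (rnorm x `^ q)); last by rewrite le_powR_lq ?rnorm_ge0.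
  by have := sel_partial_sum predT x J ui; rewrite big_mkord.
apply: (@le_trans _ _ (\sum_(j < J) rnorm (x (u j)))).
  elim/big_ind2: _ => [|a b a' b' ab ab'|j _]; first by rewrite rnorm0.
    by apply: le_trans (ler_rnormD _ _) _; exact: lerD.
  by rewrite rnormM ler_piMl ?rnorm_ge0.
apply: (@le_trans _ _ (\sum_(j < J) (h + C * rnorm (x (u j)) `^ q))).
  by apply: ler_sum => j _; apply: young; exact: rnorm_ge0.
rewrite big_split/= sumr_const card_ord -mulr_sumr -mulr_natl.
have := ler_wpM2l (ltW C0) sumle; move: BJ; rewrite ltr_pdivrMr//.
set s := \sum_(j < J) _; lra.
Qed.

End averages.

(** * Block shifts *)

Section block_shift.
Context (R : realType) (q : R) (q1 : 1 <= q) (m : nat).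
Local Notation X := (lq q1).
Local Notation M := m.+1.
Local Notation P := (trunc q1 M).
Local Notation Q := (tail q1 M).
Variables (f : nat -> nat) (fi : injective f).

(** Indices are cut into blocks of length [m.+1]: entry [r] of block [b]. *)
Definition in_block (b r : nat) : nat := (b * M + r)%N.

Definition shift_index (n : nat) : nat := in_block (f (n %/ M)) (n %% M).

Lemma divn_in_block b r : (r < M)%N -> (in_block b r %/ M = b)%N.
Proof. by move=> rM; rewrite divnMDl// divn_small ?addn0. Qed.

Lemma modn_in_block b r : (r < M)%N -> (in_block b r %% M = r)%N.
Proof. by move=> rM; rewrite modnMDl modn_small. Qed.

Lemma shift_in_block b r : (r < M)%N ->
  shift_index (in_block b r) = in_block (f b) r.
Proof. by move=> rM; rewrite /shift_index divn_in_block ?modn_in_block. Qed.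

Lemma in_block_divn n : in_block (n %/ M) (n %% M) = n.
Proof. by rewrite /in_block -divn_eq. Qed.

Lemma in_block_inj b b' r r' : (r < M)%N -> (r' < M)%N ->
  in_block b r = in_block b' r' -> b = b' /\ r = r'.
Proof.
move=> rM rM' e; split.
  by rewrite -(divn_in_block b rM) e divn_in_block.
by rewrite -(modn_in_block b rM) e modn_in_block.
Qed.

Lemma shift_index_inj : injective shift_index.
Proof.
move=> n k; rewrite /shift_index => /in_block_inj[]; rewrite ?ltn_mod//.
by move=> /fi e e'; rewrite -(in_block_divn n) e e' in_block_divn.
Qed.

Definition block_shift : blin X X := sel q1 predT shift_index_inj.

Lemma block_shiftE x b r : (r < M)%N ->
  block_shift x (in_block b r) = x (in_block (f b) r).
Proof. by move=> rM; rewrite /block_shift selE shift_in_block. Qed.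

Lemma in_block_lt b r : (r < M)%N -> (in_block b r < M)%N = (b == 0%N).
Proof.
move=> rM; case: b => [|b]; first by rewrite /in_block mul0n add0n rM.
by rewrite /in_block mulSn -addnA ltnNge leq_addr.
Qed.

Lemma in_block0 r : in_block 0 r = r. Proof. by rewrite /in_block mul0n. Qed.

Lemma block_shift_delta b r : (r < M)%N ->
  block_shift (delta q1 (in_block (f b) r)) = delta q1 (in_block b r).
Proof.
move=> rM; apply/lqP => n; rewrite -(in_block_divn n).
rewrite block_shiftE ?ltn_mod// !deltaE; congr (_%:R); congr nat_of_bool.
have nM : (n %% M < M)%N by rewrite ltn_mod.
by apply/eqP/eqP => /(in_block_inj nM rM)[] => [/fi|] -> ->.
Qed.

Lemma trunc_delta b r : (r < M)%N ->
  P (delta q1 (in_block b r)) = if b == 0%N then delta q1 (in_block b r) else 0.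
Proof.
move=> rM; apply/lqP => n; rewrite truncE -(in_block_lt b rM) !deltaE.
case: (ltnP n M) => nM; case: (ltnP (in_block b r) M) => bM //;
  rewrite ?lq0E ?deltaE//.
  by rewrite ltn_eqF// (leq_trans nM).
by rewrite gtn_eqF// (leq_trans bM).
Qed.

Lemma tail_delta b r : (r < M)%N ->
  Q (delta q1 (in_block b r)) = if b == 0%N then 0 else delta q1 (in_block b r).
Proof.
move=> rM; apply/lqP => n; rewrite tailE -(in_block_lt b rM) !deltaE.
case: (leqP M n) => nM; case: (ltnP (in_block b r) M) => bM //;
  rewrite ?lq0E ?deltaE//.
  by rewrite gtn_eqF// (leq_trans bM).
by rewrite ltn_eqF// (leq_trans nM).
Qed.

Variables (T0 : blin X X) (d : R).
Local Notation T := (perturb d M T0 block_shift).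

(** Away from block 0 the parts [(1 - d) Q S Q] and [d S] add up to [S]; on an
    arrow that enters or leaves block 0 the projection [Q] removes the first
    part, and the weight [d] remains. *)
Lemma perturb_delta_block b r : (r < M)%N -> b != 0%N -> f b != 0%N ->
  T (delta q1 (in_block (f b) r)) = delta q1 (in_block b r).
Proof.
move=> rM b0 fb0; rewrite perturbE trunc_delta// tail_delta//.
rewrite (negPf fb0) linear0 linear0 add0r block_shift_delta// tail_delta//.
by rewrite (negPf b0) -scalerDl -rmorphD/= subrK scale1r.
Qed.

Lemma perturb_delta_into0 r : (r < M)%N -> f 0%N != 0%N ->
  T (delta q1 (in_block (f 0%N) r)) = (d%:C)%C *: delta q1 r.
Proof.
move=> rM fb0; rewrite perturbE trunc_delta// tail_delta//.
rewrite (negPf fb0) linear0 linear0 add0r block_shift_delta// tail_delta//.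
by rewrite eqxx scaler0 add0r in_block0.
Qed.

Lemma perturb_delta0 r : (r < M)%N ->
  T (delta q1 r) = ((1 - d)%:C)%C *: P (T0 (delta q1 r)) +
    (d%:C)%C *: block_shift (delta q1 r).
Proof.
move=> rM; rewrite perturbE -(in_block0 r) trunc_delta// tail_delta// eqxx.
by rewrite linear0 linear0 addr0.
Qed.

Lemma adjoint_perturb_coordinate_block b r :
  (r < M)%N -> b != 0%N -> f b != 0%N ->
  adjoint T (coordinate q1 (in_block b r)) = coordinate q1 (in_block (f b) r).
Proof.
move=> rM b0 fb0; apply: blinP => x.
rewrite -[LHS]/(T x (in_block b r)) perturbE lqDE !lqZE lqDE truncE tailE.
rewrite (leqNgt M) in_block_lt// (negPf b0) add0r !block_shiftE//.
rewrite tailE (leqNgt M).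
by rewrite in_block_lt// (negPf fb0) -mulrDl -rmorphD/= subrK mul1r.
Qed.

Lemma adjoint_perturb_coordinate_into0 b r :
  (r < M)%N -> b != 0%N -> f b = 0%N ->
  adjoint T (coordinate q1 (in_block b r)) = (d%:C)%C *: coordinate q1 r.
Proof.
move=> rM b0 fb0; apply: blinP => x.
rewrite -[LHS]/(T x (in_block b r)) perturbE lqDE !lqZE lqDE truncE tailE.
rewrite (leqNgt M) in_block_lt// (negPf b0) add0r !block_shiftE//.
rewrite tailE (leqNgt M).
by rewrite in_block_lt// fb0 eqxx mulr0 add0r in_block0 blinZE.
Qed.

Lemma adjoint_perturb_coordinate0 r : (r < M)%N ->
  adjoint T (coordinate q1 r) =
    \sum_(s < M) (((1 - d)%:C)%C * T0 (delta q1 s) r) *: coordinate q1 s +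
    (d%:C)%C *: coordinate q1 (in_block (f 0%N) r).
Proof.
move=> rM; apply: blinP => x.
rewrite -[LHS]/(T x r) perturbE lqDE !lqZE lqDE truncE rM.
rewrite tailE (leqNgt M) rM addr0 -{2}(in_block0 r) block_shiftE//.
rewrite blinDE blinZE coordinateE; congr (_ + _).
rewrite (big_morph (fun g : dual X => g x)
  (fun g h => blinDE g h x) (blin0E _ x)).
have -> : T0 (P x) = \sum_(s < M) x s *: T0 (delta q1 s).
  by rewrite trunc_sum linear_sum; apply: eq_bigr => s _; exact: linearZ.
rewrite lq_sumE mulr_sumr; apply: eq_bigr => s _.
by rewrite lqZE blinZE coordinateE -[RHS]/(_ * _) mulrA mulrAC.
Qed.

End block_shift.

(** * Dense ranges of the perturbed operators *)

Lemma exists_expr_lt (R : realType) (x e : R) : 0 <= x < 1 -> 0 < e ->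
  exists j : nat, x ^+ j < e.
Proof.
move=> /andP[x0 x1] e0; have : `|x| < 1 by rewrite ger0_norm.
move=> /cvg_expr/cvgrPdist_lt/(_ e e0)[N _ /(_ N (leqnn N))].
by rewrite sub0r normrN ger0_norm ?exprn_ge0//; exists N.
Qed.

(** The orbit ... -> 4 -> 2 -> 0 -> 1 -> 3 -> ..., that is the translation of the
    integers with block 0 at the origin. *)
Definition bilateral (b : nat) : nat :=
  if b == 0%N then 1%N else if odd b then b.+2 else b.-2.

Lemma bilateral_odd k : bilateral k.*2.+1 = k.*2.+3.
Proof. by rewrite /bilateral /= odd_double. Qed.

Lemma bilateral_even k : bilateral k.*2.+2 = k.*2.
Proof. by rewrite /bilateral /= odd_double. Qed.

Lemma block_parity (Pr : nat -> Prop) :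
  Pr 0%N -> (forall k, Pr k.*2.+1) -> (forall k, Pr k.*2.+2) -> forall b, Pr b.
Proof.
move=> P0 Po Pe b; rewrite -(odd_double_half b); case: (odd b); first exact: Po.
by case: (b./2) => [//|k]; exact: Pe.
Qed.

Lemma bilateral_inj : injective bilateral.
Proof.
have b0 : bilateral 0 = 1%N by [].
move=> b b'; elim/block_parity: b => [|k|k]; elim/block_parity: b' => [|k'|k'];
  rewrite ?b0 ?bilateral_odd ?bilateral_even; lia.
Qed.

Section dense_ranges.
Context (R : realType) (q : R) (q1 : 1 <= q) (m : nat).
Local Notation X := (lq q1).
Local Notation M := m.+1.
Local Notation P := (trunc q1 M).
Local Notation in_block := (in_block m).
Variables (T0 : blin X X) (d : R).
Hypothesis d01 : 0 < d < 1.

Let d0 : (d%:C)%C != 0.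
Proof. by rewrite (inj_eq (@complexI R)) gt_eqF//; case/andP: d01. Qed.

Lemma in_block_affine_inj (g : nat -> nat) r : (r < M)%N -> injective g ->
  injective (fun j => in_block (g j) r).
Proof. by move=> rM gi j j' /(in_block_inj rM rM)[/gi]. Qed.

Lemma rnorm_pow_le1 (l : R[i]) j : rnorm l <= 1 -> rnorm (l ^+ j) <= 1.
Proof. by move=> l1; rewrite rnormX exprn_ile1 ?rnorm_ge0. Qed.

Section bilateral.
Local Notation T := (perturb d M T0 (block_shift q1 m bilateral_inj)).

(** The shift carries basis vectors against the orbit, so odd blocks come in and
    even blocks go out. *)
Lemma bilateral_dense_range (l : R[i]) n : 1 < q -> rnorm l <= 1 ->
  in_closed_range T l (delta q1 n).
Proof.
move=> q2 l1.
pose c r := delta q1 r.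
pose a k r := delta q1 (in_block k.*2.+1 r).
pose b k r := delta q1 (in_block k.*2.+2 r).
pose w r := ((1 - d)%:C)%C *: P (T0 (delta q1 r)).
have Ta r k : (r < M)%N -> T (a k.+1 r) = a k r.
  move=> rM; rewrite /a doubleS -bilateral_odd perturb_delta_block//.
  by rewrite bilateral_odd.
have Ta0 r : (r < M)%N -> T (a 0%N r) = (d%:C)%C *: c r.
  by move=> rM; exact: perturb_delta_into0.
have Tc r : (r < M)%N -> T (c r) = w r + (d%:C)%C *: b 0%N r.
  move=> rM; rewrite /c perturb_delta0//; congr (_ + _ *: _).
  have := block_shift_delta q1 bilateral_inj 2 rM.
  by rewrite (bilateral_even 0%N) in_block0.
have Tb r k : (r < M)%N -> T (b k r) = b k.+1 r.
  move=> rM; rewrite /b -{1}(doubleS k) -{1}(bilateral_even k.+1).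
  by rewrite perturb_delta_block// bilateral_even.
have ha r k : (r < M)%N -> in_closed_range T l (a k r).
  move=> rM; rewrite -[k]addn0.
  apply: (@in_closed_range_average _ _ T l (fun j => a (k + j)%N r)).
    by move=> j; rewrite addnS Ta.
  move=> e e0; apply: (@average_delta _ _ q1 (fun j => in_block (k + j).*2.+1 r)
    (fun j => l ^+ j)) => //.
    by apply: (@in_block_affine_inj (fun j => _) r rM) => j j'; lia.
  by move=> j; exact: rnorm_pow_le1.
have hw : (forall r, (r < M)%N -> in_closed_range T l (c r)) ->
    forall r, (r < M)%N -> in_closed_range T l (w r).
  move=> hc r _; apply: in_closed_rangeZ; rewrite trunc_sum.
  by apply: in_closed_range_sum => s _; apply: in_closed_rangeZ; exact: hc.
have main := bilateral_chain d0 ha Ta0 Tc hw Tb.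
have nM : (n %% M < M)%N by rewrite ltn_mod.
have [hc hb] := main _ nM.
rewrite -(in_block_divn m n); elim/block_parity: (n %/ M)%N => [|k|k].
- by rewrite in_block0.
- exact: ha.
- exact: hb.
Qed.

(** The adjoint carries coordinate functionals along the orbit, so the two
    halves exchange their roles.  Means of coordinate functionals are small even
    for [q = 1]. *)
Lemma bilateral_adjoint_dense_range (l : R[i]) n : rnorm l <= 1 ->
  in_closed_range (adjoint T) l (coordinate q1 n).
Proof.
move=> l1.
pose c r := coordinate q1 r.
pose a k r := coordinate q1 (in_block k.*2.+2 r).
pose b k r := coordinate q1 (in_block k.*2.+1 r).
pose w r :=
  \sum_(s < M) (((1 - d)%:C)%C * T0 (delta q1 s) r) *: coordinate q1 s.
have Ta r k : (r < M)%N -> adjoint T (a k.+1 r) = a k r.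
  move=> rM; rewrite /a -{1}(doubleS k).
  by rewrite adjoint_perturb_coordinate_block// bilateral_even.
have Ta0 r : (r < M)%N -> adjoint T (a 0%N r) = (d%:C)%C *: c r.
  by move=> rM; exact: adjoint_perturb_coordinate_into0.
have Tc r : (r < M)%N -> adjoint T (c r) = w r + (d%:C)%C *: b 0%N r.
  by move=> rM; exact: adjoint_perturb_coordinate0.
have Tb r k : (r < M)%N -> adjoint T (b k r) = b k.+1 r.
  move=> rM; rewrite /b.
  by rewrite adjoint_perturb_coordinate_block// bilateral_odd.
have ha r k : (r < M)%N -> in_closed_range (adjoint T) l (a k r).
  move=> rM; rewrite -[k]addn0.
  apply: (@in_closed_range_average _ _ (adjoint T) l (fun j => a (k + j)%N r)).
    by move=> j; rewrite addnS Ta.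
  move=> e e0; apply: (@average_coordinate _ _ q1
    (fun j => in_block (k + j).*2.+2 r) (fun j => l ^+ j)) => //.
    by apply: (@in_block_affine_inj (fun j => _) r rM) => j j'; lia.
  by move=> j; exact: rnorm_pow_le1.
have hw : (forall r, (r < M)%N -> in_closed_range (adjoint T) l (c r)) ->
    forall r, (r < M)%N -> in_closed_range (adjoint T) l (w r).
  move=> hc r _.
  by apply: in_closed_range_sum => s _; apply: in_closed_rangeZ; exact: hc.
have main := bilateral_chain d0 ha Ta0 Tc hw Tb.
have nM : (n %% M < M)%N by rewrite ltn_mod.
have [hc hb] := main _ nM.
rewrite -(in_block_divn m n); elim/block_parity: (n %/ M)%N => [|k|k].
- by rewrite in_block0.
- exact: hb.
- exact: ha.
Qed.

End bilateral.

Section unilateral.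
Hypothesis T01 : rnorm T0 <= 1.
Local Notation T := (perturb d M T0 (block_shift q1 m succn_inj)).

(** Blocks [k.+1 -> k] form a chain that ends in block 0, which the shift sends
    to 0.  For [q = 1] means of basis vectors are not small, so scalars inside
    the disc and on the circle are treated differently. *)
Lemma unilateral_dense_range (l : R[i]) n : rnorm l <= 1 ->
  in_closed_range T l (delta q1 n).
Proof.
move=> l1; have /andP[dgt0 dlt1] := d01.
pose a k r := delta q1 (in_block k.+1 r).
have Ta r k : (r < M)%N -> T (a k.+1 r) = a k r.
  by move=> rM; rewrite /a perturb_delta_block.
have Ta0 r : (r < M)%N -> T (a 0%N r) = (d%:C)%C *: delta q1 r.
  by move=> rM; exact: perturb_delta_into0.
have nM : (n %% M < M)%N by rewrite ltn_mod.
rewrite -(in_block_divn m n); set r := (n %% M)%N in nM *.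
suff [hc ha] : in_closed_range T l (delta q1 r) /\
    forall k, in_closed_range T l (a k r).
  by case: (n %/ M)%N => [|k]; [rewrite in_block0|exact: ha].
have [l_lt1|l_ge1] := ltP (rnorm l) 1.
  (* the terms l ^+ j *: a j of the chain tend to 0 *)
  have ha k : in_closed_range T l (a k r).
    apply: in_closed_range_small => e e0.
    have [j hj] : exists j, rnorm l ^+ j < e.
      by apply: exists_expr_lt => //; rewrite rnorm_ge0.
    exists (l ^+ j *: a (k + j)%N r).
      rewrite -[k in a k r]addn0.
      apply: (@in_closed_range_power _ _ T l (fun j => a (k + j)%N r)) => i.
      by rewrite addnS Ta.
    rewrite rnormZ rnormX; apply: le_lt_trans hj.
    by rewrite ler_piMr ?exprn_ge0 ?rnorm_ge0 ?rnorm_delta.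
  split=> //; apply: (in_closed_range_Zr d0); rewrite -(Ta0 r nM).
  have h0 := in_closed_rangeZ l (ha 0%N).
  by apply: (in_closed_range_congr _ h0); exact: in_closed_range_image.
have l0 : l != 0 by apply: contraTneq l_ge1 => ->; rewrite rnorm0 ler10.
(* on block 0 the strict contraction T / l preserves the class modulo the
   closed range, so this class contains arbitrarily small vectors *)
have hc : in_closed_range T l (delta q1 r).
  apply: in_closed_range_small => e e0.
  have [j hj] : exists j, (1 - d) ^+ j < e.
    by apply: exists_expr_lt => //; apply/andP; split; lra.
  suff [y [Py yj hy]] : exists y : X,
    [/\ P y = y, rnorm y <= (1 - d) ^+ j &
        in_closed_range T l (delta q1 r - y)].
    by exists y => //; exact: le_lt_trans yj hj.
  elim: {hj} j => [|j [y [Py yj hy]]].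
    exists (delta q1 r); split; last by rewrite subrr; exact: in_closed_range0.
      by have := trunc_delta q1 0 nM; rewrite in_block0.
    by rewrite expr0 rnorm_delta.
  have Ty : T y = ((1 - d)%:C)%C *: P (T0 y).
    have Qy : tail q1 M y = 0.
      rewrite -Py; apply/lqP => i; rewrite tailE truncE lq0E.
      by case: (leqP M i).
    have Sy : block_shift q1 m succn_inj y = 0.
      rewrite -Py; apply/lqP => i; rewrite -(in_block_divn m i).
      by rewrite block_shiftE ?ltn_mod// truncE in_block_lt ?ltn_mod.
    by rewrite perturbE Qy !linear0 Sy scaler0 !addr0 Py.
  exists (l^-1 *: T y); split.
  - rewrite Ty; apply/lqP => i; rewrite truncE !lqZE truncE.
    by case: ifP => iM; [rewrite iM|rewrite !mulr0].
  - rewrite rnormZ Ty rnormZ rnorm_real ger0_norm ?subr_ge0 ?(ltW dlt1)//.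
    rewrite exprS; apply: le_trans (_ : 1 * ((1 - d) * rnorm (P (T0 y))) <= _).
      rewrite ler_wpM2r ?mulr_ge0 ?rnorm_ge0 ?subr_ge0 ?(ltW dlt1)//.
      have : rnorm l^-1 * rnorm l = 1 by rewrite -rnormM mulVf// rnorm1.
      have := rnorm_ge0 l^-1; nra.
    rewrite mul1r ler_wpM2l ?subr_ge0 ?(ltW dlt1)//; apply: le_trans yj.
    by apply: le_trans (rnorm_trunc _ _) _; exact: contraction_le.
  - rewrite -(subrKA y); apply: in_closed_rangeD => //.
    apply: (in_closed_range_Zr l0); rewrite scalerBr scalerA divff// scale1r.
    by rewrite -opprB; apply: in_closed_rangeN; exact: in_closed_range_image.
(* the chain is climbed from block 0 upwards, dividing by l at each step *)
split=> //; elim=> [|k IH].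
  apply: (in_closed_range_Zr l0); rewrite -[_ *: _](subrK (T (a 0%N r))).
  apply: in_closed_rangeD.
    by rewrite -opprB; apply: in_closed_rangeN; exact: in_closed_range_image.
  by rewrite Ta0//; exact: in_closed_rangeZ.
apply: (in_closed_range_Zr l0); rewrite -[_ *: _](subrK (T (a k.+1 r))).
apply: in_closed_rangeD; last by rewrite Ta.
by rewrite -opprB; apply: in_closed_rangeN; exact: in_closed_range_image.
Qed.

End unilateral.

End dense_ranges.

(** * Typicality *)

Section Gdelta_sets.

Lemma Gdelta_setI (Z : topologicalType) (A B : set Z) :
  Gdelta A -> Gdelta B -> Gdelta (A `&` B).
Proof.
move=> [F oF ->] [G oG ->]; exists (fun i => F i `&` G i).
  by move=> i; exact: openI.
by rewrite bigcapI.
Qed.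

Lemma Gdelta_dense_range (R : realType) (V : normedModType R[i])
    (Z : topologicalType) (F : Z -> blin V V) (z : nat -> V) :
  (forall t v, F s v @[s --> t] --> F t v) ->
  Gdelta [set t | forall l, rnorm l <= 1 ->
    forall n, in_closed_range (F t) l (z n)].
Proof.
move=> cF.
pose G n k := [set t | forall l, rnorm l <= 1 ->
  exists y, rnorm (F t y - l *: y - z n) < k.+1%:R^-1].
exists (fun i => if unpickle i is Some p then G p.1 p.2 else setT).
  move=> i; case: unpickle => [p|]; last exact: openT.
  exact: open_dense_range.
apply/seteqP; split => [t ht i _|t ht l l1 n e e0].
  by case: unpickle => // p l l1; apply: ht => //; rewrite invr_gt0.
have [k ke] : exists k, k.+1%:R^-1 < e.
  by have /ltr_add_invr[k] := e0; rewrite add0r; exists k.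
have := ht (pickle (n, k)) I; rewrite pickleK => /(_ l l1)[y hy].
by exists y; exact: lt_trans ke.
Qed.

End Gdelta_sets.

Section typical.
Context (R : realType) (q : R) (q1 : 1 <= q).
Local Notation X := (lq q1).

Lemma P1_opP (T : P1 q1) : positive_op (P1_op T) /\ rnorm (P1_op T) <= 1.
Proof. by have := set_mem (valP T). Qed.

Lemma SOT_continuous (T : P1_SOT q1) x :
  P1_op S x @[S --> T] --> P1_op T x.
Proof.
have h := @cvg_SOTP R q q1 (nbhs T) T (nbhs_filter T).
exact: (h.1 (@cvg_id _ (nbhs T))).
Qed.

Lemma SOTs_continuous (T : P1_SOTs q1) :
  (forall x, P1_op S x @[S --> T] --> P1_op T x) /\
  (forall phi, adjoint (P1_op S) phi @[S --> T] --> adjoint (P1_op T) phi).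
Proof.
have h := @cvg_SOTsP R q q1 (nbhs T) T (nbhs_filter T).
exact: (h.1 (@cvg_id _ (nbhs T))).
Qed.

Section approximation.
Variables (f : nat -> nat) (fi : injective f) (T0 : P1 q1).

Definition mesh (n : nat) : R := n.+2%:R^-1.

Lemma mesh01 n : 0 < mesh n < 1.
Proof. by rewrite invr_gt0 ltr0n/= invf_lt1 ?ltr1n// ltr0n. Qed.

Lemma mesh_cvg (e : R) : 0 < e -> exists N, forall n, (N <= n)%N -> mesh n < e.
Proof.
move=> e0; have /ltr_add_invr[N] := e0; rewrite add0r => Ne; exists N => n Nn.
by apply: lt_trans Ne; rewrite ltf_pV2 ?posrE ?ltr0n// ltr_nat ltnS.
Qed.

Lemma approximant_subproof n :
  perturb (mesh n) n.+1 (P1_op T0) (block_shift q1 n fi) \in P1 q1.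
Proof.
have [T0p T01] := P1_opP T0; have /andP[/ltW m0 /ltW m1] := mesh01 n.
have m01 : 0 <= mesh n <= 1 by rewrite m0.
apply/mem_set; split.
  by apply: positive_perturb => //; exact: positive_sel.
apply: rnorm_perturb => //; apply: blin_le => // x.
by rewrite mul1r; exact: rnorm_sel.
Qed.

Definition approximant n : P1 q1 := SigSub (approximant_subproof n).

Lemma P1_op_approximant n : P1_op (approximant n) =
  perturb (mesh n) n.+1 (P1_op T0) (block_shift q1 n fi).
Proof. by []. Qed.

Let S1 n : rnorm (block_shift q1 n fi) <= 1.
Proof. by apply: blin_le => // x; rewrite mul1r; exact: rnorm_sel. Qed.

Lemma approximant_cvg x :
  P1_op (approximant n) x @[n --> \oo] --> P1_op T0 x.
Proof.
have [T0p T01] := P1_opP T0; apply/cvg_rnormP => e e0.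
suff [N hN] : exists N, forall n, (N <= n)%N ->
    rnorm (P1_op (approximant n) x - P1_op T0 x) < e.
  by exists N => // n Nn; rewrite rnormC; exact: hN.
have e6 : 0 < e / 9 by rewrite divr_gt0.
have [N1 h1] := rnorm_tail_lt x e6.
have [N2 h2] := rnorm_tail_lt (P1_op T0 x) e6.
have x2 : 0 <= 2 * rnorm x by rewrite mulr_ge0 ?rnorm_ge0.
have [N3 h3] := mesh_cvg (divD1_gt0 x2 e6).
exists (maxn N1 (maxn N2 N3)) => n; rewrite !geq_max => /and3P[n1 n2 n3].
rewrite P1_op_approximant.
have /andP[/ltW m0 _] := mesh01 n.
apply: le_lt_trans (rnorm_perturbB _ _ m0 T01 (S1 n)) _.
have := h1 n.+1 (leqW n1); have := h2 n.+1 (leqW n2).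
have := ler_mul_divD1 x2 e6 (ltW (h3 n n3)); lra.
Qed.

Lemma approximant_adjoint_cvg (phi : dual X) : 1 < q ->
  adjoint (P1_op (approximant n)) phi @[n --> \oo] --> adjoint (P1_op T0) phi.
Proof.
move=> q2; have [T0p T01] := P1_opP T0; apply/cvg_rnormP => e e0.
suff [N hN] : exists N, forall n, (N <= n)%N ->
    rnorm (adjoint (P1_op (approximant n)) phi - adjoint (P1_op T0) phi) < e.
  by exists N => // n Nn; rewrite rnormC; exact: hN.
have e6 : 0 < e / 9 by rewrite divr_gt0.
have [N1 h1] := rnorm_dual_tail_lt phi q2 e6.
have [N2 h2] := rnorm_dual_tail_lt (adjoint (P1_op T0) phi) q2 e6.
have x2 : 0 <= 2 * rnorm phi by rewrite mulr_ge0 ?rnorm_ge0.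
have [N3 h3] := mesh_cvg (divD1_gt0 x2 e6).
exists (maxn N1 (maxn N2 N3)) => n; rewrite !geq_max => /and3P[n1 n2 n3].
rewrite P1_op_approximant.
have /andP[/ltW m0 _] := mesh01 n.
apply: le_lt_trans (rnorm_adjoint_perturbB _ _ m0 T01 (S1 n)) _.
have := h1 n.+1 (leqW n1); have := h2 n.+1 (leqW n2).
have := ler_mul_divD1 x2 e6 (ltW (h3 n n3)); lra.
Qed.

End approximation.
End typical.

Lemma dense_by_sequences (Z : topologicalType) (G : set Z) :
  (forall t : Z, exists2 u : nat -> Z, (forall n, G (u n)) & u @ \oo --> t) ->
  dense G.
Proof.
move=> h O [t Ot] oO; have [u Gu ut] := h t.
have : \forall n \near \oo, O (u n) by apply: ut; exact: open_nbhs_nbhs.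
by move=> [N _ /(_ N (leqnn N))] ON; exists (u N).
Qed.

Theorem corollary3p3 (R : realType) (q : R) (q1 : 1 <= q) :
  typical [set T : P1_SOT q1 |
    forall l : R[i], ~ is_eigenvalue (adjoint (P1_op T)) l] /\
  (1 < q ->
    typical [set T : P1_SOTs q1 |
      (forall l : R[i], ~ is_eigenvalue (P1_op T) l) /\
      (forall l : R[i], ~ is_eigenvalue (adjoint (P1_op T)) l)]).
Proof.
split=> [|q2].
  exists [set T : P1_SOT q1 | forall l, rnorm l <= 1 ->
      forall n, in_closed_range (P1_op T) l (delta q1 n)]; last first.
    move=> T /= hT; apply: adjoint_no_eigenvalue => //.
    by have [] := P1_opP T.
  split.
    apply: (@Gdelta_dense_range _ _ (P1_SOT q1) (@P1_op R q q1)) => T x.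
    exact: SOT_continuous.
  apply: dense_by_sequences => T; exists (approximant succn_inj T).
    move=> n l l1 k; rewrite P1_op_approximant.
    by apply: unilateral_dense_range => //; [exact: mesh01|have [] := P1_opP T].
  apply/cvg_SOTP => x; exact: approximant_cvg.
exists ([set T : P1_SOTs q1 | forall l, rnorm l <= 1 ->
      forall n, in_closed_range (P1_op T) l (delta q1 n)] `&`
    [set T : P1_SOTs q1 | forall l, rnorm l <= 1 ->
      forall n, in_closed_range (adjoint (P1_op T)) l (coordinate q1 n)]).
  split.
    apply: Gdelta_setI.
      apply: (@Gdelta_dense_range _ _ (P1_SOTs q1) (@P1_op R q q1)) => T x.
      by have [] := SOTs_continuous T.
    apply: (@Gdelta_dense_range _ _ (P1_SOTs q1)
      (fun T => adjoint (@P1_op R q q1 T))) => T phi.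
    by have [] := SOTs_continuous T.
  apply: dense_by_sequences => T; exists (approximant bilateral_inj T).
    move=> n; split=> l l1 k; rewrite P1_op_approximant.
      by apply: bilateral_dense_range => //; exact: mesh01.
    by apply: bilateral_adjoint_dense_range => //; exact: mesh01.
  apply/cvg_SOTsP; split => [x|phi]; first exact: approximant_cvg.
  exact: approximant_adjoint_cvg.
move=> T /= [hT hTs]; have [_ T1] := P1_opP T; split.
  exact: no_eigenvalue.
exact: adjoint_no_eigenvalue.
Qed.
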